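(* Let $I$ be a stable ideal in a skew polynomial ring $R=k_{\mathfrak q}[x_1,\ldots,x_n]$ with $n$ variables. Then: (1) The Betti numbers of $I$ are given by $$\beta_q(I)=\sum_{u\in G(I)}\binom{\max(u)-1}{q}.$$ (2) The projective dimension of $I$ is given by $$\mathrm{pd}_R I=\max\{\max(u)-1\mid u\in G(I)\}.$$ (3) The Poincaré series of $I$ is given by $$\mathrm P^R_I(t)=\sum_{u\in G(I)}\frac{t^{\deg(u)}}{(1-t)^{\,n-\max(u)+1}}.$$
   Context: $k$ is a commutative Noetherian ring. Skew polynomial ring: $q_{i,j}\in k^*$ ($1\le i,j\le n$) satisfy $q_{i,i}=1$ and $q_{j,i}=q_{i,j}^{-1}$, and $R=k_{\mathfrak q}[x_1,\ldots,x_n]$ is the iterated Ore extension of $k$ with $k$ central and $x_ix_j=q_{i,j}x_jx_i$. $R$ is $\mathbb Z$-graded by $\deg x_i=d_i\in\mathbb Z^+$. Monomials are the elements $\mathbf x^{\mathbf a}=x_1^{a_1}\cdots x_n^{a_n}$, $\mathbf a\in\mathbb N^n$. Put $\mathbf x^{\mathbf a}*\mathbf x^{\mathbf b}:=\mathbf x^{\mathbf a+\mathbf b}$, and $\frac{\mathbf x^{\mathbf a}}{\mathbf x^{\mathbf b}}:=\mathbf x^{\mathbf a-\mathbf b}$ when $a_i\ge b_i$ for all $i$. For a monomial $w=x_1^{a_1}\cdots x_n^{a_n}$, $\max(w)=\max\{i\mid a_i>0\}$. A monomial ideal is an ideal of $R$ generated by monomials. A monomial ideal $I$ is stable if for every monomial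 $w\in I$ and every index $i<\max(w)$, the monomial $\frac{x_i*w}{x_{\max(w)}}$ is in $I$. $G(I)$ denotes the unique minimal set of monomial generators of $I$ (no element is a proper multiple of another). Modules are graded right $R$-modules. $\beta_q(I)$ is the rank of the free module in homological degree $q$ of a minimal graded free resolution $F_\bullet\to I$ over $R$, where minimal means $d(F_q)\subseteq F_{q-1}(x_1,\ldots,x_n)$ for $q\ge1$; $\mathrm{pd}_R I$ is the projective dimension of $I$. The Poincaré series $\mathrm P^R_I(t)$ of the graded module $I=\bigoplus_j I_j$ is the generating function $\sum_j(\mathrm{rank}_k I_j)\,t^j$ of the ranks of its graded components.
   Formalization: Part (3) is proved only when all deg x_i = 1: for other degrees the printed series is false (n=1, deg x_1=2, I=(x_1) has series t^2/(1-t^2)), and it fails for every nonzero stable ideal. The convention max(1)=1 is used, and k is nonzero. *)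

(* Defs.v *)
From HB Require Import structures.
From mathcomp Require Import all_boot all_order all_algebra.
From mathcomp Require Export mpoly.
From mathcomp Require Import ssrcomplements zify ring.
From Stdlib Require Import Classical.

Set Implicit Arguments.
Unset Strict Implicit.
Unset Printing Implicit Defensive.

Import GRing.Theory.
Local Open Scope ring_scope.

(* [skewpoly q] is the free [k]-module on the monomials [x^a], with
   [x^a x^b = qcoef q a b x^(a+b)]: the factor [q i j] is collected each time
   an [x_i] of [x^a] is moved to the right across an [x_j] of [x^b], [j < i].
   The lemmas [xmonE], [xvarC], [xmon_basis] and [xmon_free] say that [x^a] is the ordered
   product [x_1^a_1 ... x_n^a_n], that [x_i x_j = q_(i,j) x_j x_i], and that
   these ordered products form a [k]-basis, i.e. that this is the iterated Ore
   extension. *)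
Section SkewPoly.
Variables (n : nat) (k : comUnitRingType).

Definition skewpoly (q : 'I_n -> 'I_n -> k) : Type := {mpoly k[n]}.

Variable q : 'I_n -> 'I_n -> k.
Local Notation R := (skewpoly q).

HB.instance Definition _ := GRing.Lmodule.copy R {mpoly k[n]}.

Definition qcoef (a b : 'X_{1..n}) : k :=
  \prod_(i < n) \prod_(j < n | (j < i)%N) q i j ^+ (a i * b j).

Definition xmon (a : 'X_{1..n}) : R := 'X_[a] : {mpoly k[n]}.

Definition xvar (i : 'I_n) : R := xmon U_(i).

Definition xcoef (a : 'X_{1..n}) (f : R) : k := (f : {mpoly k[n]})@_a.

Definition skew_mul (f g : R) : R :=
  \sum_(a <- msupp (f : {mpoly k[n]})) \sum_(b <- msupp (g : {mpoly k[n]}))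
    (xcoef a f * xcoef b g * qcoef a b) *: xmon (a + b).

Lemma qcoefDl a a' b : qcoef (a + a')%MM b = qcoef a b * qcoef a' b.
Proof.
rewrite /qcoef -big_split; apply: eq_bigr => i _ /=.
rewrite -big_split; apply: eq_bigr => j _ /=.
by rewrite mnmDE mulnDl exprD.
Qed.

Lemma qcoefDr a b b' : qcoef a (b + b')%MM = qcoef a b * qcoef a b'.
Proof.
rewrite /qcoef -big_split; apply: eq_bigr => i _ /=.
rewrite -big_split; apply: eq_bigr => j _ /=.
by rewrite mnmDE mulnDr exprD.
Qed.

Lemma qcoef0l b : qcoef 0%MM b = 1.
Proof. by rewrite /qcoef big1 // => i _; rewrite big1 // => j _; rewrite mnm0E. Qed.

Lemma qcoef0r a : qcoef a 0%MM = 1.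
Proof.
by rewrite /qcoef big1 // => i _; rewrite big1 // => j _; rewrite mnm0E muln0.
Qed.

Lemma skew_mulw m (f g : R) :
    (msize (f : {mpoly k[n]}) <= m)%N -> (msize (g : {mpoly k[n]}) <= m)%N ->
  skew_mul f g = \sum_(a : 'X_{1..n < m}) \sum_(b : 'X_{1..n < m})
    (xcoef a f * xcoef b g * qcoef a b) *: xmon (a + b).
Proof.
move=> lef leg; pose I : subFinType _ := 'X_{1..n < m}.
rewrite /skew_mul (big_mksub I) ?msupp_uniq //=; first last.
  by move=> x /msize_mdeg_lt /leq_trans; apply.
rewrite big_rmcond /=; last first.
  by move=> i /memN_msupp_eq0 h; rewrite big1 // => j _; rewrite /xcoef h !mul0r scale0r.
apply: eq_bigr => a _; rewrite (big_mksub I) ?msupp_uniq //=; first last.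
  by move=> x /msize_mdeg_lt /leq_trans; apply.
rewrite big_rmcond //= => i /memN_msupp_eq0 h.
by rewrite /xcoef h mulr0 mul0r scale0r.
Qed.

Lemma skew_mulDl : left_distributive skew_mul +%R.
Proof.
move=> f g h; pose m := (msize (f : {mpoly k[n]}) + msize (g : {mpoly k[n]})
   + msize (h : {mpoly k[n]}) + msize (f + g : {mpoly k[n]}))%N.
rewrite !(@skew_mulw m); do ?[by rewrite /m; lia].
rewrite -big_split; apply: eq_bigr => a _; rewrite -big_split.
by apply: eq_bigr => b _; rewrite /xcoef mcoeffD !mulrDl scalerDl.
Qed.

Lemma skew_mulDr : right_distributive skew_mul +%R.
Proof.
move=> h f g; pose m := (msize (f : {mpoly k[n]}) + msize (g : {mpoly k[n]})
   + msize (h : {mpoly k[n]}) + msize (f + g : {mpoly k[n]}))%N.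
rewrite !(@skew_mulw m); do ?[by rewrite /m; lia].
rewrite -big_split; apply: eq_bigr => a _; rewrite -big_split.
by apply: eq_bigr => b _; rewrite /xcoef mcoeffD mulrDr mulrDl scalerDl.
Qed.

Lemma skew_mul0l (f : R) : skew_mul 0 f = 0.
Proof. by rewrite /skew_mul msupp0 big_nil. Qed.

Lemma skew_mul0r (f : R) : skew_mul f 0 = 0.
Proof. by rewrite /skew_mul msupp0 big1 // => a _; rewrite big_nil. Qed.

Lemma skew_mulZl c (f g : R) : skew_mul (c *: f) g = c *: skew_mul f g.
Proof.
pose m := (msize (f : {mpoly k[n]}) + msize (g : {mpoly k[n]})
   + msize (c *: f : {mpoly k[n]}))%N.
rewrite !(@skew_mulw m); do ?[by rewrite /m; lia].
rewrite scaler_sumr; apply: eq_bigr => a _; rewrite scaler_sumr.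
by apply: eq_bigr => b _; rewrite /xcoef mcoeffZ scalerA !mulrA.
Qed.

Lemma skew_mulZr c (f g : R) : skew_mul f (c *: g) = c *: skew_mul f g.
Proof.
pose m := (msize (f : {mpoly k[n]}) + msize (g : {mpoly k[n]})
   + msize (c *: g : {mpoly k[n]}))%N.
rewrite !(@skew_mulw m); do ?[by rewrite /m; lia].
rewrite scaler_sumr; apply: eq_bigr => a _; rewrite scaler_sumr.
by apply: eq_bigr => b _; rewrite /xcoef mcoeffZ scalerA !mulrA (mulrC c).
Qed.

Lemma skew_mulX a b : skew_mul (xmon a) (xmon b) = qcoef a b *: xmon (a + b).
Proof.
by rewrite /skew_mul !msuppX !big_seq1 /xcoef !mcoeffX !eqxx !mul1r.
Qed.

Lemma skewE (f : R) :
  f = \sum_(a <- msupp (f : {mpoly k[n]})) xcoef a f *: xmon a.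
Proof. exact: mpolyE. Qed.

Lemma skew_mulA : associative skew_mul.
Proof.
have suml (I : Type) (s : seq I) (F : I -> R) g :
    skew_mul (\sum_(i <- s) F i) g = \sum_(i <- s) skew_mul (F i) g.
  by apply: (big_morph (skew_mul^~ g)) => [u v|]; rewrite ?skew_mulDl ?skew_mul0l.
have sumr (I : Type) (s : seq I) (F : I -> R) g :
    skew_mul g (\sum_(i <- s) F i) = \sum_(i <- s) skew_mul g (F i).
  by apply: (big_morph (skew_mul g)) => [u v|]; rewrite ?skew_mulDr ?skew_mul0r.
move=> f g h; rewrite (skewE f) suml (suml _ _ _ g) suml; apply: eq_bigr => a _.
rewrite (skewE g) (suml _ _ _ h) (sumr _ _ _ (_ *: _)) (sumr _ _ _ (_ *: _)) suml; apply: eq_bigr => b _.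
rewrite (skewE h) (sumr _ _ _ (xcoef b g *: _)) (sumr _ _ _ (xcoef a f *: _)).
rewrite (sumr _ _ _ (skew_mul _ _)); apply: eq_bigr => c _.
rewrite !(skew_mulZl, skew_mulZr, skew_mulX) !scalerA addmA.
by rewrite qcoefDl qcoefDr; congr (_ *: _); ring.
Qed.

Lemma skew_mul1l : left_id (xmon 0) skew_mul.
Proof.
move=> f; rewrite [RHS]skewE /skew_mul msuppX big_seq1; apply: eq_bigr => b _.
by rewrite /xcoef mcoeffX eqxx mul1r qcoef0l mulr1 add0m.
Qed.

Lemma skew_mul1r : right_id (xmon 0) skew_mul.
Proof.
move=> f; rewrite [RHS]skewE /skew_mul msuppX; apply: eq_bigr => b _.
by rewrite big_seq1 /xcoef mcoeffX eqxx qcoef0r !mulr1 addm0.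
Qed.

Lemma skew_1neq0 : xmon 0 != 0.
Proof.
apply/eqP => /(congr1 (xcoef 0)) /eqP.
by rewrite /xcoef mcoeffX eqxx mcoeff0 oner_eq0.
Qed.

HB.instance Definition _ := GRing.Zmodule_isNzRing.Build R
  skew_mulA skew_mul1l skew_mul1r skew_mulDl skew_mulDr skew_1neq0.
HB.instance Definition _ := GRing.Lmodule_isLalgebra.Build k R
  (fun c f g => esym (skew_mulZl c f g)).
HB.instance Definition _ := GRing.Lalgebra_isAlgebra.Build k R
  (fun c f g => esym (skew_mulZr c f g)).

Lemma xmonM a b : xmon a * xmon b = qcoef a b *: xmon (a + b).
Proof. exact: skew_mulX. Qed.

Lemma xmon_basis (f : R) :
  f = \sum_(a <- msupp (f : {mpoly k[n]})) xcoef a f *: xmon a.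
Proof. exact: skewE. Qed.

Lemma xmon_free (s : seq 'X_{1..n}) (c : 'X_{1..n} -> k) b : uniq s ->
  xcoef b (\sum_(a <- s) c a *: xmon a) = if b \in s then c b else 0.
Proof.
have coefE a : xcoef b (c a *: xmon a) = if a == b then c b else 0.
  by rewrite /xcoef mcoeffZ mcoeffX; case: eqP => [->|]; rewrite ?mulr1 ?mulr0.
elim: s => [|a s IH] /=; first by rewrite big_nil /xcoef mcoeff0.
case/andP=> as_ /IH e; rewrite big_cons {1}/xcoef mcoeffD -!/(xcoef b _) e coefE.
rewrite inE eq_sym; case: eqP as_ => [->|_ _] /=; last by rewrite add0r.
by move/negbTE=> ->; rewrite addr0.
Qed.

Lemma qcoefUU i j : qcoef U_(i) U_(j) = if (j < i)%N then q i j else 1.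
Proof.
rewrite /qcoef (bigD1 i) //= [X in _ * X]big1 => [|i' ne].
  rewrite mulr1; case: ltnP => ji.
    rewrite (bigD1 j) //= big1 => [|j' /andP[_ ne]].
      by rewrite mulr1 !mnm1E !eqxx expr1.
    by rewrite !mnm1E [j == j']eq_sym (negbTE ne) muln0.
  rewrite big1 // => j' ltj; rewrite !mnm1E; case: eqP => [_|//]; case: eqP => // e.
  by move: ltj; rewrite -e ltnNge ji.
by rewrite big1 // => j' _; rewrite !mnm1E [i == i']eq_sym (negbTE ne).
Qed.

Lemma xvarC i j :
    (forall i, q i i = 1) -> (forall i j, q i j \is a GRing.unit) ->
    (forall i j, q j i = (q i j)^-1) ->
  xvar i * xvar j = q i j *: (xvar j * xvar i).
Proof.
move=> q1 qU qV; rewrite /xvar !xmonM !qcoefUU addmC.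
case: (ltngtP i j) => ij; rewrite ?scalerA ?mulr1 ?scale1r //.
  by rewrite qV mulVr // scale1r.
by rewrite (val_inj ij) q1 scale1r.
Qed.

Lemma qcoef_eq1 (a b : 'X_{1..n}) :
  (forall i j : 'I_n, (j < i)%N -> (a i * b j)%N = 0%N) -> qcoef a b = 1.
Proof.
by move=> ab0; rewrite /qcoef big1 // => i _; rewrite big1 // => j /ab0 ->.
Qed.

Lemma xvarX i m : xvar i ^+ m = xmon (U_(i) *+ m).
Proof.
elim: m => [//|m IH]; rewrite exprS IH xmonM qcoef_eq1 ?scale1r ?mulmS //.
move=> i' j lt; rewrite mulmnE !mnm1E.
case: eqP => [ii|//]; case: eqP => [ij|//].
by move: lt; rewrite -ii -ij ltnn.
Qed.

Lemma xmonE (a : 'X_{1..n}) : xmon a = \prod_(i < n) xvar i ^+ a i.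
Proof.
suff prodE (s : seq 'I_n) : sorted ltn (map val s) ->
    \prod_(i <- s) xvar i ^+ a i = xmon (\sum_(i <- s) U_(i) *+ a i).
  have := prodE (enum 'I_n); rewrite val_enum_ord iota_ltn_sorted.
  have -> : enum 'I_n = index_enum 'I_n by rewrite [index_enum _]unlock enumT.
  by rewrite -multinomUE_id => ->.
elim: s => [|i s IH]; first by rewrite !big_nil.
rewrite /= (path_sortedE ltn_trans) => /andP[/allP lt_s /IH e].
rewrite !big_cons e xvarX xmonM qcoef_eq1 ?scale1r // => i' j lt.
rewrite mulmnE mnm1E; case: eqP => [ii|//]; rewrite mnm_sumE.
rewrite big_seq big1 ?muln0 // => j' js; rewrite mulmnE mnm1E.
case: eqP => [jj|//]; have := lt_s _ (map_f val js).
by move: lt; rewrite -ii -jj /= => /ltnW; rewrite leqNgt => /negbTE ->.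
Qed.

End SkewPoly.

Section Ideals.
Variable R : pzRingType.
Implicit Types I J S : R -> Prop.

Definition is_ideal I : Prop :=
  [/\ I 0,
      forall f g, I f -> I g -> I (f + g),
      forall f g, I g -> I (f * g) &
      forall f g, I f -> I (f * g)].

Definition ideal_gen S (f : R) : Prop :=
  forall J, is_ideal J -> (forall s, S s -> J s) -> J f.

Definition noetherian : Prop :=
  forall I, is_ideal I ->
    exists s : seq R, forall f, I f <-> ideal_gen (fun g => g \in s) f.

End Ideals.

(* A right [R]-module is a left module over the converse ring [R^c]; in
   particular [R^c^o] is [R] with right multiplication. *)
Notation rmodType R := (lmodType R^c).
Notation rreg R := (R^c^o)%type.

Section Resolutions.
Variable R : nzRingType.

(* [... -> P_1 -> P_0 -> I -> 0] is exact; the right ideal [I] is represented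
   as the image of [e] inside [R]. *)
Definition is_resolution (I : R -> Prop) (P : nat -> rmodType R)
    (d : forall q, {linear P q.+1 -> P q}) (e : {linear P 0%N -> rreg R}) :
    Prop :=
  [/\ forall f : R, I f <-> exists p, e p = f,
      forall p, e p = 0 <-> exists p', d 0%N p' = p &
      forall q p, d q p = 0 <-> exists p', d q.+1 p' = p].

Definition projective (P : rmodType R) : Prop :=
  forall (M N : rmodType R) (g : {linear M -> N}) (f : {linear P -> N}),
    (forall y, exists x, g x = y) ->
    exists h : {linear P -> M}, forall p, g (h p) = f p.

Definition has_proj_resolution (I : R -> Prop) (m : nat) : Prop :=
  exists (P : nat -> rmodType R) (d : forall q, {linear P q.+1 -> P q})
         (e : {linear P 0%N -> rreg R}),
    [/\ is_resolution I d e,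
        forall q, projective (P q) &
        forall q, (m < q)%N -> forall p : P q, p = 0].

(* The zero ideal gets projective dimension [0]. *)
Definition is_projdim (I : R -> Prop) (m : nat) : Prop :=
  has_proj_resolution I m /\
  forall m', has_proj_resolution I m' -> (m <= m')%N.

(* [R(-a_1) (+) ... (+) R(-a_b)]: a free module with a basis [e_1, ..., e_b]
   of homogeneous elements, [e_i] in degree [a_i]. *)
Record gfree := GFree {
  gf_mod :> rmodType R;
  gf_rank : nat;
  gf_basis : 'I_gf_rank -> gf_mod;
  gf_deg : 'I_gf_rank -> int;
  gf_basisP : forall v, exists! c : {ffun 'I_gf_rank -> R^c},
    v = \sum_i c i *: gf_basis i
}.

(* [hom j f]: [f] lies in the component of degree [j] of the ring [R]. *)
Variable hom : int -> R -> Prop.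

Definition gf_hom (F : gfree) (j : int) (v : F) : Prop :=
  exists2 c : 'I_(gf_rank F) -> R^c,
    forall i, hom (j - gf_deg i) (c i) & v = \sum_i c i *: gf_basis i.

Definition in_mul_ideal (M : rmodType R) (J : R -> Prop) (w : M) : Prop :=
  exists (m : nat) (v : 'I_m -> M) (r : 'I_m -> R),
    (forall i, J (r i)) /\ w = \sum_i (r i : R^c) *: v i.

Definition is_min_gfree_resolution (J I : R -> Prop) (F : nat -> gfree)
    (d : forall q, {linear F q.+1 -> F q}) (e : {linear F 0%N -> rreg R}) :
    Prop :=
  [/\ is_resolution I d e,
      forall j v, gf_hom j v -> hom j (e v),
      forall q j v, gf_hom j v -> gf_hom j (d q v) &
      forall q v, in_mul_ideal J (d q v)].

(* The ranks are independent of the minimal resolution; both this and the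
   existence of such a resolution are part of the definition. *)
Definition is_betti (J I : R -> Prop) (beta : nat -> nat) : Prop :=
  (exists F d e, @is_min_gfree_resolution J I F d e) /\
  forall F d e, @is_min_gfree_resolution J I F d e ->
    forall q, gf_rank (F q) = beta q.

End Resolutions.

(* Coefficients of the power series expansion of [p / u], for [u`_0 = 1]. *)
Section Fraction.
Variables p u : {poly int}.

Fixpoint frac_coefs (m : nat) : seq int :=
  if m is m'.+1 then
    let s := frac_coefs m' in
    rcons s (p`_m' - \sum_(i < m') s`_i * u`_(m' - i))
  else [::].

Definition fps_frac (j : nat) : int := (frac_coefs j.+1)`_j.

Lemma size_frac_coefs m : size (frac_coefs m) = m.
Proof. by elim: m => //= m IH; rewrite size_rcons IH. Qed.

Lemma frac_coefsE m j : (j < m)%N -> (frac_coefs m)`_j = fps_frac j.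
Proof.
elim: m => // m IH; rewrite ltnS leq_eqVlt => /orP[/eqP -> //|lt].
by rewrite /= nth_rcons size_frac_coefs lt IH.
Qed.

Lemma fps_fracP j : u`_0 = 1 ->
  \sum_(i < j.+1) fps_frac i * u`_(j - i) = p`_j.
Proof.
move=> u0; rewrite big_ord_recr /= subnn u0 mulr1 {2}/fps_frac /=.
rewrite nth_rcons size_frac_coefs ltnn eqxx addrC -[RHS](subrK
  (\sum_(i < j) (frac_coefs j)`_i * u`_(j - i))); congr (_ + _).
by apply: eq_bigr => i _; rewrite frac_coefsE.
Qed.

End Fraction.

Section MonomialIdeals.
Variables (n : nat) (k : comUnitRingType) (q : 'I_n -> 'I_n -> k).
Local Notation R := (skewpoly q).
Implicit Types (I : R -> Prop) (w u v : 'X_{1..n}).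

(* The variables are numbered from [1]: [i : 'I_n] stands for [x_(i+1)]. By
   convention [max(1) = 1]. *)
Definition maxv w : nat := maxn 1 (\max_(i < n | (0 < w i)%N) i.+1).

Definition monomial_ideal I : Prop :=
  exists S : 'X_{1..n} -> Prop, forall f,
    I f <-> ideal_gen (fun g => exists2 u, S u & g = xmon q u) f.

Definition stable_ideal I : Prop :=
  monomial_ideal I /\
  forall w, I (xmon q w) -> forall i j : 'I_n,
    j.+1 = maxv w -> (i.+1 < maxv w)%N ->
    I (xmon q ((U_(i) + w) - U_(j))).

Definition is_min_gens I (G : seq 'X_{1..n}) : Prop :=
  [/\ uniq G,
      forall f,
        I f <-> ideal_gen (fun g => exists2 u, u \in G & g = xmon q u) f &
      forall u v, u \in G -> v \in G -> (u <= v)%MM -> u = v].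

Lemma dickson (S : 'X_{1..n} -> Prop) :
  exists s : seq 'X_{1..n}, (forall u, u \in s -> S u) /\
    forall w, S w -> exists2 u, u \in s & (u <= w)%MM.
Proof.
suff [s [sS sP]] : exists s : seq 'X_{1..n}, (forall u, u \in s -> S u) /\
    forall w, S w -> exists2 u, u \in s & {in enum 'I_n, forall i, u i <= w i}%N.
  exists s; split => // w /sP[u us uw]; exists u => //.
  by apply/mnm_lepP => i; apply: uw; rewrite mem_enum.
elim: (enum 'I_n) S => [|i r IH] S.
  have [[u Su]|nS] := classic (exists u, S u).
    by exists [:: u]; split=> [v|w _]; [rewrite inE => /eqP->|exists u; rewrite ?inE].
  by exists [::]; split=> // w Sw; case: nS; exists w.
have [s [sS sP]] := IH S; pose M := \max_(u <- s) u i.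
have [t [tS tP]] : exists t : seq 'X_{1..n}, (forall u, u \in t -> S u) /\
    forall w, S w -> (w i < M)%N ->
      exists2 u, u \in t & {in i :: r, forall j, u j <= w j}%N.
  elim: M => [|m [t [tS tP]]]; first by exists [::].
  have [t' [t'S t'P]] := IH (fun w => S w /\ w i = m).
  exists (t' ++ t); split=> [u|w Sw].
    by rewrite mem_cat => /orP[/t'S[]|/tS].
  rewrite ltnS leq_eqVlt => /orP[/eqP wm|/(tP _ Sw)[u ut uw]]; last first.
    by exists u => //; rewrite mem_cat ut orbT.
  have [u ut' uw] := t'P w (conj Sw wm); have [_ um] := t'S u ut'.
  exists u => [|j]; first by rewrite mem_cat ut'.
  by rewrite inE => /orP[/eqP->|/uw//]; rewrite um wm.
exists (s ++ t); split=> [u|w Sw]; first by rewrite mem_cat => /orP[/sS|/tS].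
have [/(tP _ Sw)[u ut uw]|Mw] := ltnP (w i) M.
  by exists u => //; rewrite mem_cat ut orbT.
have [u us uw] := sP w Sw; exists u => [|j]; first by rewrite mem_cat us.
rewrite inE => /orP[/eqP->|/uw//].
by apply: leq_trans Mw; rewrite /M (big_rem u us) leq_maxl.
Qed.

Lemma min_gens_exists I :
    (forall i j, q i j \is a GRing.unit) -> monomial_ideal I ->
  exists G, is_min_gens I G.
Proof.
move=> qU [S IS]; have [s [sS sP]] := dickson S.
pose minimal u := all (fun v => (v <= u)%MM ==> (v == u)) s.
pose G := undup (filter minimal s).
have below u : u \in s -> exists2 v, v \in G & (v <= u)%MM.
  have [m] := ubnP (mdeg u); elim: m u => // m IH u lt_u us.
  have [mu|/allPn[v vs]] := boolP (minimal u).
    by exists u; rewrite ?lepm_refl // mem_undup mem_filter mu us.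
  rewrite negb_imply => /andP[vu ne].
  have ltvu : (mdeg v < mdeg u)%N.
    have e := submK vu; rewrite -e mdegD -[X in (X < _)%N]add0n ltn_add2r lt0n.
    by apply: contra ne; rewrite mdeg_eq0 => /eqP e0; rewrite -e e0 add0m.
  have [w wG wv] := IH v (leq_trans ltvu lt_u) vs.
  by exists w => //; apply: lepm_trans wv vu.
have GS u : u \in G -> u \in s by rewrite mem_undup mem_filter => /andP[].
exists G; split=> [|f|u v uG vG uv]; first exact: undup_uniq.
- rewrite IS; split=> H J Ji JS; apply: H => // g [u].
    move=> /sP[v vs vu] ->; have [w wG wv] := below v vs.
    have wu := lepm_trans wv vu; case: Ji => _ _ Jl _.
    have cU : qcoef q (u - w)%MM w \is a GRing.unit.
      by rewrite rpred_prod // => i _; rewrite rpred_prod // => j _; rewrite unitrX.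
    have -> : xmon q u = (qcoef q (u - w)%MM w)^-1 *: xmon q (u - w) * xmon q w.
      by rewrite -scalerAl xmonM scalerA mulVr // scale1r submK.
    by apply: Jl; apply: JS; exists w.
  by move=> uG ->; apply: JS; exists u => //; apply/sS/GS.
move: vG; rewrite mem_undup mem_filter => /andP[/allP/(_ u (GS _ uG))].
by rewrite uv => /eqP.
Qed.

Definition maxideal : R -> Prop :=
  ideal_gen (fun g => exists i, g = xvar q i).

Variable d : 'I_n -> nat.

Definition wdeg w : nat := (\sum_(i < n) d i * w i)%N.

Definition whom (j : int) (f : R) : Prop :=
  forall w, xcoef w f != 0 -> (wdeg w)%:Z = j.

(* The component [I_j] is a free [k]-module of rank [r]. *)
Definition component_rank I (j : nat) (r : nat) : Prop :=
  exists b : 'I_r -> R,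
    (forall i, I (b i) /\ whom j (b i)) /\
    (forall f, I f -> whom j f ->
       exists! c : {ffun 'I_r -> k}, f = \sum_i c i *: b i).

Definition is_poincare_series I (P : nat -> int) : Prop :=
  forall j, exists2 r : nat, component_rank I j r & P j = r%:Z.

End MonomialIdeals.

(* Main.v *)
(* Adding the generators of a stable ideal one at a time, by increasing degree
   and, within a degree, by increasing [sum_i i * a_i], each colon ideal is
   generated by the variables strictly before the last variable of the new
   generator [u].  The mapping cone of a lift [K(-u) -> F] of multiplication by
   [u], with [F] the resolution built so far and [K] the Koszul-type resolution
   (itself an iterated mapping cone) of the colon ideal, adds
   ['C(max u - 1, l)] generators in homological degree [l].  It stays minimal
   because the new generators of degree [l] have total degree [deg u + l], more
   than that of the generators of [F] they are mapped to.  The same colon ideals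
   split the monomials of [I] into the products [u * w] with [w] in the variables
   from [max u] on, which gives the Poincare series.  The ranks of a minimal
   resolution and the lower bound for the projective dimension come from the
   comparison theorem: the identity of a minimal resolution [F] agrees modulo
   [F * (x_1, ..., x_n)] with a map factoring through any projective
   resolution. *)
From HB Require Import structures.
Require Import Defs.
From mathcomp Require Import all_boot all_order all_algebra mpoly.
From mathcomp Require Import zify ring.
From Stdlib Require Import IndefiniteDescription.

Set Implicit Arguments.
Unset Strict Implicit.
Unset Printing Implicit Defensive.

Import GRing.Theory.
Local Open Scope ring_scope.

(** * Projective resolutions *)

Section Pullback.
Variables (R : nzRingType) (P M N : lmodType R).
Variables (f : {linear P -> N}) (g : {linear M -> N}).

Definition pullback : {pred P * M} := fun x => f x.1 == g x.2.

Fact pullback_submod : submod_closed pullback.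
Proof.
split=> [|c x y]; first by rewrite unfold_in !linear0.
by rewrite !unfold_in => /eqP ex /eqP ey; rewrite !linearP ex ey.
Qed.

HB.instance Definition _ :=
  GRing.isSubmodClosed.Build R (P * M)%type pullback pullback_submod.

Definition pullback_mod := {x : P * M | x \in pullback}.
HB.instance Definition _ := [isSub of pullback_mod for @sval _ _].
HB.instance Definition _ := [Choice of pullback_mod by <:].
HB.instance Definition _ := [SubChoice_isSubLmodule of pullback_mod by <:].

Definition pullback_fst (x : pullback_mod) : P := (val x).1.
Definition pullback_snd (x : pullback_mod) : M := (val x).2.

Fact pullback_fst_linear : linear pullback_fst.
Proof. by []. Qed.
Fact pullback_snd_linear : linear pullback_snd.
Proof. by []. Qed.

HB.instance Definition _ :=
  GRing.isLinear.Build R pullback_mod P *:%R pullback_fst pullback_fst_linear.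
HB.instance Definition _ :=
  GRing.isLinear.Build R pullback_mod M *:%R pullback_snd pullback_snd_linear.

End Pullback.

(** * The comparison theorem for projective resolutions *)

Section Comparison.
Variable R : nzRingType.

(* [projective] only speaks of surjections; lifting the identity of [P] through
   the pullback avoids forming the image of [g] as a module. *)
Lemma projective_lift (P M N : rmodType R) (f : {linear P -> N})
    (g : {linear M -> N}) : projective P ->
  (forall p, exists x, g x = f p) ->
  exists h : {linear P -> M}, forall p, g (h p) = f p.
Proof.
move=> projP gf; pose Q := pullback_mod f g.
have [|h hK] := projP Q P (@pullback_fst _ _ _ _ f g) idfun.
  move=> p; have [x e] := gf p.
  have px : (p, x) \in pullback f g by rewrite unfold_in e.
  by exists (Sub (p, x) px); rewrite /= /pullback_fst SubK.
exists (@pullback_snd _ _ _ _ f g \o h) => p /=.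
by have := valP (h p); rewrite unfold_in => /eqP <-; congr (f _); apply: hK.
Qed.

Variable I : R -> Prop.

Lemma resolution_dd P d e : @is_resolution R I P d e ->
  forall q p, d q (d q.+1 p) = 0.
Proof. by case=> _ _ ex q p; apply/ex; exists p. Qed.

Lemma resolution_ed P d e : @is_resolution R I P d e ->
  forall p, e (d 0%N p) = 0.
Proof. by case=> _ ex _ p; apply/ex; exists p. Qed.

(** Projectivity lifts each component through a differential of the target. The invariant [ok] says
    that the composite with the incoming source differential lands in the image of the target
    differential, which is what the next lift requires. *)
Lemma comparison_map P d e P' d' e' :
    @is_resolution R I P d e -> @is_resolution R I P' d' e' ->
    (forall q, projective (P q)) ->
  exists f : forall q, {linear P q -> P' q},
    (forall p, e' (f 0%N p) = e p) /\
    forall q p, d' q (f q.+1 p) = f q (d q p).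
Proof.
move=> res res' proj.
pose ok q (f : {linear P q -> P' q}) := forall p, exists p', d' q p' = f (d q p).
have [f0 ef0] : exists f0 : {linear P 0%N -> P' 0%N}, forall p, e' (f0 p) = e p.
  apply: projective_lift (proj 0%N) _ => p; have [[im _ _] [im' _ _]] := (res, res').
  by apply/im'; apply/im; exists p.
have ok0 : ok 0%N f0.
  move=> p; have [_ ex _] := res'; apply/ex.
  by rewrite ef0 (resolution_ed res).
have step q (f : {f | ok q f}) : exists f' : {f | ok q.+1 f},
    forall p, d' q (sval f' p) = sval f (d q p).
  case: f => f okf.
  have [f' ef'] := projective_lift (f := f \o d q) (g := d' q) (proj _) okf.
  have okf' : ok q.+1 f'.
    move=> p; have [_ _ ex] := res'; apply/ex.
    by rewrite ef' /= (resolution_dd res) linear0.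
  by exists (exist _ f' okf').
(* The lifts exist only propositionally; indefinite description turns each step into a function that
   can be iterated. *)
pose next q f := sval (constructive_indefinite_description _ (@step q f)).
pose F := nat_rect (fun q => {f | ok q f}) (exist _ f0 ok0) next.
exists (fun q => sval (F q)); split=> [|q p]; first exact: ef0.
exact: (svalP (constructive_indefinite_description _ (@step q (F q)))).
Qed.

(** A chain map lifting zero is null-homotopic. The components are not assembled into one family, as
    a consecutive pair in each degree is enough for the use of minimality. *)
Lemma null_homotopy (P : nat -> rmodType R) d e (phi : forall q, {linear P q -> P q}) :
    @is_resolution R I P d e -> (forall q, projective (P q)) ->
    (forall p, e (phi 0%N p) = 0) ->
    (forall q p, d q (phi q.+1 p) = phi q (d q p)) ->
  (exists h : {linear P 0%N -> P 1%N}, forall p, phi 0%N p = d 0%N (h p)) /\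
  forall q, exists (h : {linear P q -> P q.+1}) (h' : {linear P q.+1 -> P q.+2}),
    forall p, phi q.+1 p = d q.+1 (h' p) + h (d q p).
Proof.
move=> res proj ephi dphi; have [_ ex0 ex] := res.
have [h0 eh0] : exists h : {linear P 0%N -> P 1%N}, forall p, d 0%N (h p) = phi 0%N p.
  by apply: projective_lift => // p; apply/ex0.
split; first by exists h0.
have next q (h : {linear P q -> P q.+1}) :
    (forall p, d q (h (d q p)) = phi q (d q p)) ->
  exists h' : {linear P q.+1 -> P q.+2},
    forall p, phi q.+1 p = d q.+1 (h' p) + h (d q p).
  move=> eh.
  have [p|h' eh'] := projective_lift (f := phi q.+1 \- (h \o d q)) (g := d q.+1) (proj _).
    by apply/ex; rewrite linearB /= dphi eh subrr.
  by exists h' => p; rewrite eh' /= subrK.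
(* On the image of [d q] the homotopy relation reduces to [d h = phi]; this weaker statement carries
   the induction. *)
suff H q : exists h : {linear P q -> P q.+1}, forall p, d q (h (d q p)) = phi q (d q p).
  by move=> q; have [h /next[h' eh]] := H q; exists h, h'.
elim: q => [|q [h /next[h' eh]]]; first by exists h0.
by exists h' => p; rewrite eh (resolution_dd res) linear0 addr0.
Qed.

Variable J : R -> Prop.

Lemma in_mul_ideal_linear (M N : rmodType R) (h : {linear M -> N}) w :
  in_mul_ideal J w -> in_mul_ideal J (h w).
Proof.
case=> m [v [r [Jr ->]]]; exists m, (h \o v), r; split=> //.
by rewrite linear_sum; apply: eq_bigr => i _; rewrite linearZ.
Qed.

Lemma in_mul_idealD (M : rmodType R) (v w : M) :
  in_mul_ideal J v -> in_mul_ideal J w -> in_mul_ideal J (v + w).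
Proof.
case=> m [x [r [Jr ->]]] [m' [x' [r' [Jr' ->]]]].
exists (m + m')%N, (fun i => match split i with inl j => x j | inr j => x' j end),
  (fun i => match split i with inl j => r j | inr j => r' j end).
split=> [i|]; first by case: split.
rewrite big_split_ord; congr (_ + _); apply: eq_bigr => i _.
  by rewrite (unsplitK (inl i)).
by rewrite (unsplitK (inr i)).
Qed.

(** Both [g f] and the identity lift the identity of [I], so they differ by [d h' + h d]. Minimality
    puts the values of [d] in [F J], and the linear map [h] keeps them there. *)
Lemma minimal_retract F d e P d' e' :
    @is_resolution R I F d e -> (forall q v, in_mul_ideal J (d q v)) ->
    (forall q, projective (F q)) ->
    @is_resolution R I P d' e' -> (forall q, projective (P q)) ->
  forall q, exists (f : {linear F q -> P q}) (g : {linear P q -> F q}),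
    forall v, in_mul_ideal J (g (f v) - v).
Proof.
move=> res min projF res' projP.
have [f [ef df]] := comparison_map res res' projF.
have [g [eg dg]] := comparison_map res' res projP.
pose phi q : {linear F q -> F q} := (g q \o f q) \- idfun.
have [||[h0 eh0] hS] := null_homotopy (phi := phi) res projF.
- by move=> p; rewrite /phi linearB /= eg ef subrr.
- by move=> q p; rewrite /phi !linearB /= dg df.
move=> q; exists (f q), (g q) => v; rewrite -[_ - _]/(phi q v).
case: q v => [|q] v; first by rewrite eh0.
have [h [h' ->]] := hS q; apply: in_mul_idealD => //.
exact: in_mul_ideal_linear.
Qed.

End Comparison.

(** * Graded free modules and their ranks modulo the augmentation *)

Section FreeModules.
Variable R : nzRingType.

Fact gf_coord_ex (F : gfree R) (v : F) :
  exists c : {ffun 'I_(gf_rank F) -> R^c}, v == \sum_i c i *: gf_basis i.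
Proof. by have [c [/eqP e _]] := gf_basisP v; exists c. Qed.

Definition gf_coord (F : gfree R) (v : F) := xchoose (gf_coord_ex v).

Lemma gf_coordE (F : gfree R) (v : F) : v = \sum_i gf_coord v i *: gf_basis i.
Proof. exact/eqP/(xchooseP (gf_coord_ex v)). Qed.

Lemma gf_coord_sum (F : gfree R) (c : 'I_(gf_rank F) -> R^c) i :
  gf_coord (\sum_i c i *: gf_basis i) i = c i.
Proof.
have [c' [_ u]] := gf_basisP (\sum_i c i *: gf_basis i).
have e1 := u _ (gf_coordE _).
have e2 := u (finfun c).
rewrite -e1 e2 ?ffunE //; apply: eq_bigr => j _; by rewrite ffunE.
Qed.

Lemma gf_coord_linear (F : gfree R) i c (v w : F) :
  gf_coord (c *: v + w) i = c * gf_coord v i + gf_coord w i.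
Proof.
rewrite -(gf_coord_sum (fun i => c * gf_coord v i + gf_coord w i)).
congr (gf_coord _ i); rewrite {1}(gf_coordE v) {1}(gf_coordE w) scaler_sumr -big_split.
by apply: eq_bigr => j _; rewrite scalerDl scalerA.
Qed.

Lemma gfree_projective (F : gfree R) : projective F.
Proof.
move=> M N g f surj.
have [m em] := fin_all_exists (fun i => surj (f (gf_basis i))).
pose h (v : F) := \sum_i gf_coord v i *: m i.
have hlin : linear h.
  move=> c v w; rewrite /h scaler_sumr -big_split; apply: eq_bigr => i _.
  by rewrite gf_coord_linear scalerDl scalerA.
pose lh := GRing.isLinear.Build _ _ _ _ h hlin.
exists (HB.pack_for {linear F -> M} h lh) => v /=.
rewrite /h linear_sum {2}(gf_coordE v) linear_sum; apply: eq_bigr => i _.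
by rewrite !linearZ em.
Qed.

(** The coordinate as a map into the regular module, so that the general lemmas on linear maps apply
    to it. *)
Definition gf_proj (F : gfree R) (i : 'I_(gf_rank F)) (v : F) : R^c^o :=
  gf_coord v i.

HB.instance Definition _ F i := GRing.isLinear.Build R^c _ _ *:%R
  (@gf_proj F i) (@gf_coord_linear F i).

Lemma gf_coord_basis (F : gfree R) (i j : 'I_(gf_rank F)) :
  gf_coord (gf_basis i) j = (i == j)%:R.
Proof.
rewrite -(gf_coord_sum (fun j => (i == j)%:R)); congr (gf_coord _ j).
rewrite (bigD1 i) //= eqxx scale1r big1 ?addr0 // => l ne.
by rewrite eq_sym (negbTE ne) scale0r.
Qed.

Lemma gf_coord_map (F F' : gfree R) (g : {linear F -> F'}) v i :
  gf_coord (g v) i = \sum_j gf_coord v j * gf_coord (g (gf_basis j)) i.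
Proof.
rewrite -[LHS]/(gf_proj i _) {1}(gf_coordE v) !linear_sum; apply: eq_bigr => j _.
by rewrite !linearZ.
Qed.

Variables (k : comNzRingType) (eps : {rmorphism R -> k}) (J : R -> Prop).
Hypothesis eps_J : forall r, J r -> eps r = 0.

Lemma eps_in_mul_ideal (F : gfree R) (v : F) i :
  in_mul_ideal J v -> eps (gf_coord v i) = 0.
Proof.
case=> m [x [r [Jr ->]]]; rewrite -[gf_coord _ _]/(gf_proj i _) linear_sum.
rewrite raddf_sum big1 // => j _; rewrite linearZ.
(* Scaling in the regular module over the converse ring is right multiplication in [R]. *)
change (eps ((gf_proj i (x j) : R) * r j) = 0).
by rewrite rmorphM /= (eps_J (Jr j)) mulr0.
Qed.

(** Applying [eps] to the matrices of [f] and [g] gives [A B = 1] over the nonzero commutative ring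
    [k], which bounds the size of the identity matrix by the inner dimension. *)
Lemma gf_rank_retract (F F' : gfree R) (f : {linear F -> F'})
    (g : {linear F' -> F}) :
  (forall v, in_mul_ideal J (g (f v) - v)) -> (gf_rank F <= gf_rank F')%N.
Proof.
move=> gf.
pose A := \matrix_(i < gf_rank F, j < gf_rank F') eps (gf_coord (f (gf_basis i)) j).
pose B := \matrix_(j < gf_rank F', i < gf_rank F) eps (gf_coord (g (gf_basis j)) i).
apply: (@mulmx1_min _ _ _ A B); apply/matrixP => i l; rewrite !mxE.
have /eqP := eps_in_mul_ideal l (gf (gf_basis i)).
rewrite -[gf_coord _ _]/(gf_proj l _) linearB rmorphB subr_eq0 /= /gf_proj.
rewrite gf_coord_basis gf_coord_map !rmorph_sum rmorph_nat => /eqP <-.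
(* Products in the converse ring are reversed; commutativity of [k] undoes this. *)
by apply: eq_bigr => j _; rewrite !mxE mulrC -rmorphM.
Qed.

Lemma min_resolution_rank_le I F d e F' d' e' hom :
    @is_min_gfree_resolution R hom J I F d e ->
    @is_min_gfree_resolution R hom J I F' d' e' ->
  forall q, (gf_rank (F q) <= gf_rank (F' q))%N.
Proof.
move=> [res _ _ min] [res' _ _ _] q.
have proj (F0 : nat -> gfree R) q0 := @gfree_projective (F0 q0).
by have [f [g /gf_rank_retract]] := minimal_retract res min (proj _) res' (proj _) q.
Qed.

(** Beyond degree [m] the identity of [F q] factors through zero modulo [F J], so a basis vector
    would have a coordinate with [1 = 0] under [eps]. *)
Lemma min_resolution_length I F d e hom m :
    @is_min_gfree_resolution R hom J I F d e -> has_proj_resolution I m ->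
  forall q, (m < q)%N -> gf_rank (F q) = 0%N.
Proof.
move=> [res _ _ min] [P [d' [e' [res' proj' P0]]]] q mq.
have proj q0 := @gfree_projective (F q0).
have [f [g gf]] := minimal_retract res min proj res' proj' q.
apply/eqP; rewrite -leqn0 leqNgt; apply/negP => lt; pose i := Ordinal lt.
have coordN (v : F q) : gf_coord (- v) i = - gf_coord v i.
  exact: (linearN (gf_proj i)).
have /eqP := eps_in_mul_ideal i (gf (gf_basis i)).
rewrite (P0 q mq (f _)) linear0 sub0r coordN rmorphN.
by rewrite oppr_eq0 gf_coord_basis eqxx rmorph1 oner_eq0.
Qed.

End FreeModules.

(** * Coefficients in a skew polynomial ring *)

Section SkewCoefs.
Variables (n : nat) (k : comUnitRingType) (q : 'I_n -> 'I_n -> k).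
Local Notation R := (skewpoly q).
Implicit Types (f g : R) (a b m w : 'X_{1..n}).

Lemma xcoefP f g : (forall m, xcoef m f = xcoef m g) -> f = g.
Proof. by move=> e; apply/mpolyP => m; apply: e. Qed.

Fact xcoef_is_linear m : linear (xcoef m : R -> k^o).
Proof. by move=> c f g; rewrite /xcoef mcoeffD mcoeffZ. Qed.

HB.instance Definition _ m := GRing.isLinear.Build k R k^o *:%R
  (xcoef m) (xcoef_is_linear m).

Lemma xcoef_sum (T : Type) (r : seq T) (P : pred T) (F : T -> R) m :
  xcoef m (\sum_(i <- r | P i) F i) = \sum_(i <- r | P i) xcoef m (F i).
Proof. exact: linear_sum. Qed.

Lemma xcoef0 m : xcoef m (0 : R) = 0.
Proof. exact: linear0. Qed.

Lemma xcoefN m f : xcoef m (- f) = - xcoef m f.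
Proof. exact: linearN. Qed.

Lemma xcoefD m f g : xcoef m (f + g) = xcoef m f + xcoef m g.
Proof. exact: linearD. Qed.

Lemma xcoefZ m c f : xcoef m (c *: f) = c * xcoef m f.
Proof. exact: linearZ. Qed.

Lemma xcoef_xmon m a : xcoef m (xmon q a) = (a == m)%:R.
Proof. exact: mcoeffX. Qed.

Lemma xcoefM w f g : xcoef w (f * g) =
  \sum_(a <- msupp (f : {mpoly k[n]})) \sum_(b <- msupp (g : {mpoly k[n]}))
     xcoef a f * xcoef b g * qcoef q a b * (a + b == w)%MM%:R.
Proof.
rewrite -[f * g]/(skew_mul f g) xcoef_sum; apply: eq_bigr => a _.
rewrite xcoef_sum; apply: eq_bigr => b _; by rewrite xcoefZ xcoef_xmon.
Qed.

Lemma xcoef_supp f m : (m \in msupp (f : {mpoly k[n]})) = (xcoef m f != 0).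
Proof. by rewrite mcoeff_msupp. Qed.

Lemma xcoefM_eq0 w f g :
    (forall a b, xcoef a f != 0 -> xcoef b g != 0 -> w != (a + b)%MM) ->
  xcoef w (f * g) = 0.
Proof.
move=> H; rewrite xcoefM big_seq big1 // => a; rewrite xcoef_supp => fa.
rewrite big_seq big1 // => b; rewrite xcoef_supp => gb.
by rewrite eq_sym (negbTE (H _ _ fa gb)) mulr0.
Qed.

Lemma xcoefM_neq0 w f g : xcoef w (f * g) != 0 ->
  exists a b, [/\ xcoef a f != 0, xcoef b g != 0 & w = (a + b)%MM].
Proof.
move=> ne0.
have /hasP[a fa /hasP[b gb /eqP e]] : has (fun a => has (fun b => w == a + b)%MM
    (msupp (g : {mpoly k[n]}))) (msupp (f : {mpoly k[n]})).
  apply: contraNT ne0 => /hasPn H; rewrite xcoefM_eq0 // => a b.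
  by rewrite -!xcoef_supp => /H /hasPn; apply.
by exists a, b; rewrite -!xcoef_supp fa gb.
Qed.

(** Multiplication by a monomial keeps distinct exponents distinct, so a single term contributes. *)
Lemma xcoef_xmonM u m f : xcoef (u + m) (xmon q u * f) = qcoef q u m * xcoef m f.
Proof.
rewrite {1}(xmon_basis f) mulr_sumr xcoef_sum.
transitivity (\sum_(a <- msupp (f : {mpoly k[n]}))
    if a == m then qcoef q u m * xcoef m f else 0).
  apply: eq_bigr => a _; rewrite -scalerAr xmonM scalerA xcoefZ xcoef_xmon.
  rewrite eqm_add2l; case: eqP => [->|_]; last by rewrite mulr0.
  by rewrite mulr1 mulrC.
rewrite -big_mkcond /=; have [|] := boolP (m \in msupp (f : {mpoly k[n]})).
  by move=> ms; rewrite -big_filter filter_pred1_uniq ?msupp_uniq // big_seq1.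
move=> nm; rewrite big_seq_cond big1; first by rewrite /xcoef memN_msupp_eq0 ?mulr0.
by move=> a /andP[am /eqP e]; rewrite -e am in nm.
Qed.

(** Used mainly with predicates fixing a multidegree, to extract homogeneous components. *)
Definition trunc (P : pred 'X_{1..n}) f : R :=
  \sum_(m <- msupp (f : {mpoly k[n]}) | P m) xcoef m f *: xmon q m.

Lemma xcoef_trunc P f m : xcoef m (trunc P f) = if P m then xcoef m f else 0.
Proof.
rewrite /trunc -big_filter xmon_free ?filter_uniq ?msupp_uniq // mem_filter.
rewrite xcoef_supp; case: (P m) => //=; by case: eqP.
Qed.

Fact trunc_is_linear P : linear (trunc P).
Proof.
move=> c f g; apply: xcoefP => m; rewrite !(xcoefD, xcoefZ, xcoef_trunc).
by case: (P m); rewrite ?mulr0 ?addr0.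
Qed.

HB.instance Definition _ P := GRing.isLinear.Build k R R *:%R
  (trunc P) (trunc_is_linear P).

Lemma trunc_id (P : pred 'X_{1..n}) f :
  (forall m, xcoef m f != 0 -> P m) -> trunc P f = f.
Proof.
move=> H; apply: xcoefP => m; rewrite xcoef_trunc; case: ifPn => // nP.
by apply/esym/eqP; apply: contraNT nP => /H.
Qed.

Lemma trunc_0 (P : pred 'X_{1..n}) f :
  (forall m, xcoef m f != 0 -> ~~ P m) -> trunc P f = 0.
Proof.
move=> H; apply: xcoefP => m; rewrite xcoef_trunc linear0; case: ifPn => // Pm.
by apply/eqP; apply: contraTT Pm => /H.
Qed.

Lemma truncD P f : f = trunc P f + trunc (predC P) f.
Proof.
apply: xcoefP => m; rewrite xcoefD !xcoef_trunc /=.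
by case: (P m); rewrite ?addr0 ?add0r.
Qed.

Lemma trunc_neq0 P f m : xcoef m (trunc P f) != 0 -> P m && (xcoef m f != 0).
Proof. by rewrite xcoef_trunc; case: (P m); rewrite ?eqxx. Qed.

(** A sum of exponents vanishes only if both do, so only the constant terms meet in the constant
    term of a product. This morphism is later the augmentation [eps]. *)
Fact const_is_monoid : monoid_morphism (xcoef 0%MM : R -> k).
Proof.
split=> [|f g]; first by rewrite [LHS]xcoef_xmon eqxx.
rewrite {1}(truncD (pred1 0%MM) f) mulrDl xcoefD.
rewrite [X in _ + X]xcoefM_eq0 ?addr0 => [|a b /trunc_neq0/andP[/= ne _] _]; last first.
  by rewrite eq_sym mnmD_eq0 negb_and ne.
have -> : trunc (pred1 0%MM) f = xcoef 0%MM f *: 1.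
  apply: xcoefP => m; rewrite xcoef_trunc xcoefZ xcoef_xmon /=.
  by case: (eqVneq m 0%MM) => [->|_]; rewrite ?eqxx ?mulr1 ?mulr0.
by rewrite -scalerAl mul1r xcoefZ.
Qed.

Definition const_coef f : k := xcoef 0%MM f.

HB.instance Definition _ := GRing.isZmodMorphism.Build R k const_coef
   (fun f g => linearB (xcoef 0%MM) f g).
HB.instance Definition _ := GRing.isMonoidMorphism.Build R k const_coef
   const_is_monoid.

(* [f] is homogeneous of multidegree [a - b]. *)
Definition mhom b a f := forall m, xcoef m f != 0 -> (m + b = a)%MM.

Lemma mhom0 b a : mhom b a 0.
Proof. by move=> m; rewrite linear0 eqxx. Qed.

Lemma mhomN b a f : mhom b a f -> mhom b a (- f).
Proof. by move=> H m; rewrite linearN oppr_eq0 => /H. Qed.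

Lemma mhomM b c a f g : mhom b c g -> mhom c a f -> mhom b a (g * f).
Proof.
move=> hg hf m /xcoefM_neq0[x [y [/hg ec /hf <- ->]]].
by rewrite -ec addmA (addmC y).
Qed.

(** Multiplication by a homogeneous element shifts all multidegrees by the same amount, so it
    commutes with taking components. *)
Lemma trunc_mul b a w f g : mhom b a g ->
  trunc (fun m => m + b == w)%MM (g * f) = g * trunc (fun m => m + a == w)%MM f.
Proof.
move=> hg; rewrite {1}(truncD (fun m => m + a == w)%MM f) mulrDr linearD /=.
rewrite trunc_id => [|m /xcoefM_neq0[x [y [/hg e /trunc_neq0/andP[/eqP <- _] ->]]]].
  rewrite [X in _ + X]trunc_0 ?addr0 // => m /xcoefM_neq0[x [y [/hg e]]].
  move=> /trunc_neq0/andP[/= ne _] ->; by apply: contra ne => /eqP <-; rewrite -e addmA (addmC y).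
by rewrite -e addmA (addmC y).
Qed.

Hypothesis q_unit : forall i j, q i j \is a GRing.unit.

Lemma qcoef_unit a b : qcoef q a b \is a GRing.unit.
Proof.
by rewrite rpred_prod // => i _; rewrite rpred_prod // => j _; rewrite unitrX.
Qed.

Lemma xmon_dvdr u w : (u <= w)%MM -> exists g, xmon q w = xmon q u * g.
Proof.
move=> uw; exists ((qcoef q u (w - u))^-1 *: xmon q (w - u)).
rewrite -scalerAr xmonM scalerA mulVr ?qcoef_unit // scale1r addmC submK //.
Qed.

Lemma xmon_dvdl u w : (u <= w)%MM -> exists g, xmon q w = g * xmon q u.
Proof.
move=> uw; exists ((qcoef q (w - u) u)^-1 *: xmon q (w - u)).
by rewrite -scalerAl xmonM scalerA mulVr ?qcoef_unit // scale1r submK.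
Qed.

Lemma xmonM_factor u f : (forall w, xcoef w f != 0 -> (u <= w)%MM) ->
  exists g, f = xmon q u * g.
Proof.
move=> H; have {H} : {in msupp (f : {mpoly k[n]}), forall w, u <= w}%MM.
  by move=> w; rewrite xcoef_supp => /H.
(* The induction runs over the list of exponents while the coefficients of [f] stay fixed. *)
rewrite {2}(xmon_basis f); elim: (msupp _) => [|w s IH] H.
  by exists 0; rewrite big_nil mulr0.
have [|g eg] := IH; first by move=> x xs; apply: H; rewrite inE xs orbT.
have [|h eh] := @xmon_dvdr u w; first by apply: H; rewrite inE eqxx.
by exists (xcoef w f *: h + g); rewrite big_cons eg eh mulrDr scalerAr.
Qed.

Section IdealGen.
Variable S : pred 'X_{1..n}.
Hypothesis S_up : forall u m, S u -> S (u + m)%MM.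

Lemma monomial_span_ideal : is_ideal (fun f => forall w, xcoef w f != 0 -> S w).
Proof.
split=> [w|f g Hf Hg w|f g Hg w|f g Hf w].
- by rewrite linear0 eqxx.
- rewrite xcoefD; case: (eqVneq (xcoef w f) 0) => [/= ->|/Hf //].
  by rewrite add0r => /Hg.
- by move=> /xcoefM_neq0[x [y [_ /Hg Sy ->]]]; rewrite addmC; apply: S_up.
- by move=> /xcoefM_neq0[x [y [/Hf Sx _ ->]]]; apply: S_up.
Qed.

End IdealGen.

(** The combinations of monomials divisible by a generator form a two-sided ideal, and each such
    monomial is a left multiple of a generator because the [qcoef] are units. *)
Lemma ideal_genP (s : seq 'X_{1..n}) f :
  ideal_gen (fun g => exists2 u, u \in s & g = xmon q u) f <->
  forall w, xcoef w f != 0 -> has (fun u => u <= w)%MM s.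
Proof.
split=> [H|H J [J0 JD Jl Jr] JS].
  apply: (H _ (@monomial_span_ideal (fun w => has (fun u => u <= w)%MM s) _)).
    move=> u m /hasP[v vs vu]; apply/hasP; exists v => //.
    by apply: lepm_trans vu _; rewrite lem_addr.
  move=> g [u us ->] w; rewrite xcoef_xmon.
  case: (eqVneq u w) => [<- _|_]; last by rewrite eqxx.
  by apply/hasP; exists u; rewrite ?lepm_refl.
rewrite (xmon_basis f) big_seq; apply: big_ind => // w; rewrite xcoef_supp.
move=> /H/hasP[u us /xmon_dvdl[g ->]]; rewrite scalerAl.
by apply: Jl; apply: JS; exists u.
Qed.

(** A nonconstant monomial has a variable as right factor, so the ideal of the variables is the
    kernel of the augmentation. *)
Lemma maxidealP f : xcoef 0%MM f = 0 <-> maxideal f.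
Proof.
split=> [f0 J [J0 JD Jl Jr] JS|H]; last first.
  apply: (H (fun f => xcoef 0%MM f = 0)) => [|g [i ->]]; last first.
    by rewrite xcoef_xmon mnm1_eq0.
  split=> [|g h|g h|g h]; rewrite ?linear0 // ?xcoefD.
  - by move=> -> ->; rewrite addr0.
  - by move=> e; rewrite -[LHS]/(const_coef _) rmorphM /= /const_coef e mulr0.
  - by move=> e; rewrite -[LHS]/(const_coef _) rmorphM /= /const_coef e mul0r.
rewrite (xmon_basis f) big_seq; apply: big_ind => // w; rewrite xcoef_supp => fw.
have : w != 0%MM by apply: contraNneq fw => ->; rewrite f0.
rewrite -mdeg_eq0 mdegE; rewrite sum_nat_eq0 negb_forall => /existsP[i /=].
rewrite -lt0n => wi.
have [|g ->] := @xmon_dvdl U_(i) w; first by rewrite lep1mP -lt0n.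
by rewrite scalerAl; apply: Jl; apply: JS; exists i.
Qed.

End SkewCoefs.

(** * Mapping cones of multigraded resolutions *)

(* Adding the generators of [s] from the last to the first, every colon ideal
   [(s') : u] is generated by the variables before the last variable of [u]. *)
Definition linear_quotients n (s : seq 'X_{1..n}) : Prop :=
  forall t u s', s = t ++ u :: s' ->
    (forall v, v \in s' -> mdeg v <= mdeg u)%N /\
    forall m, has (fun v => v <= u + m)%MM s' =
              [exists i : 'I_n, (i < maxv u - 1)%N && (0 < m i)%N].

Section MonomialResolutions.
Variables (n : nat) (k : comUnitRingType) (q : 'I_n -> 'I_n -> k).
Local Notation R := (skewpoly q).
Local Notation S := (R^c)%type.
Local Notation mnm := 'X_{1..n}.

(* Right [R]-linear maps are right multiplications of row vectors over [S] by
   matrices over [S]; the products of entries are reversed products in [R]. *)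
Lemma converse_mulE (x y : S) : x * y = ((y : R) * (x : R) : R).
Proof. by []. Qed.

(** Matrices of degree-preserving maps between free modules with basis elements in multidegrees [a]
    and [c]. *)
Definition mhom_mx p r (a : 'I_p -> mnm) (c : 'I_r -> mnm) (D : 'M[S]_(p, r)) :=
  forall i j, mhom (c j) (a i) (D i j : R).

Lemma mhom_mxM p r s a b c (A : 'M[S]_(p, r)) (B : 'M[S]_(r, s)) :
  mhom_mx a b A -> mhom_mx b c B -> mhom_mx a c (A *m B).
Proof.
move=> hA hB i j m; rewrite mxE xcoef_sum => ne0.
have [l _ ne] : exists2 l, true & xcoef m (A i l * B l j : R) != 0.
  apply/exists_inP; apply: contraNT ne0 => /exists_inPn H.
  by rewrite big1 // => l _; apply/eqP; rewrite -[_ == _]negbK H.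
by rewrite (mhomM (hB _ _) (hA _ _) ne).
Qed.

Definition row_trunc p (a : 'I_p -> mnm) w (v : 'rV[S]_p) : 'rV[S]_p :=
  \row_j (trunc (fun m => m + a j == w)%MM (v 0 j : R)).

Lemma row_trunc_mul p r (a : 'I_p -> mnm) (c : 'I_r -> mnm) D w v :
  mhom_mx a c D -> row_trunc c w (v *m D) = row_trunc a w v *m D.
Proof.
move=> hD; apply/rowP => j; rewrite !mxE linear_sum; apply: eq_bigr => i _.
by rewrite mxE converse_mulE /= (trunc_mul _ _ (hD i j)).
Qed.

(** Any preimage of a row may be replaced by its component in the multidegree of that row:
    truncation commutes with [D] and fixes the rows of [V]. *)
Lemma mhom_lift p r s (a : 'I_p -> mnm) (c : 'I_r -> mnm) (e : 'I_s -> mnm) D V :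
    mhom_mx a c D -> mhom_mx e c V -> (forall i, exists x, row i V = x *m D) ->
  exists2 X, V = X *m D & mhom_mx e a X.
Proof.
move=> hD hV /fin_all_exists[x ex].
exists (\matrix_(i, j) row_trunc a (e i) (x i) 0 j) => [|i j m]; last first.
  by rewrite !mxE => /trunc_neq0/andP[/eqP].
apply/row_matrixP => i; rewrite row_mul.
have -> : row i (\matrix_(i, j) row_trunc a (e i) (x i) 0 j) = row_trunc a (e i) (x i).
  by apply/rowP => j; rewrite !mxE.
rewrite -(row_trunc_mul _ _ hD) -ex; apply/rowP => j; rewrite !mxE.
by rewrite trunc_id // => m /hV ->.
Qed.

Definition rk (b : nat -> nat) l := if l is l'.+1 then b l' else 1%N.

(* A multigraded free resolution of the cyclic module [R / (monomials in J)] by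
   modules of ranks [1, b 0, b 1, ...]. *)
Definition is_monres (J : pred mnm) b (a : forall l, 'I_(rk b l) -> mnm)
    (D : forall l, 'M[S]_(rk b l.+1, rk b l)) : Prop :=
  [/\ forall i, a 0%N i = 0%MM,
      forall l, mhom_mx (a l.+1) (a l) (D l),
      forall l, D l.+1 *m D l = 0,
      forall l (v : 'rV_(rk b l.+1)), v *m D l = 0 -> exists w, v = w *m D l.+1 &
      forall f : S, (exists w : 'rV_(b 0%N), (f%:M : 'M_1) = w *m D 0%N) <->
                    forall m, xcoef m (f : R) != 0 -> J m].

Hypothesis q_unit : forall i j, q i j \is a GRing.unit.

Section Cone.
Variables (J J' : pred mnm) (b b' : nat -> nat).
Variables (a : forall l, 'I_(rk b l) -> mnm) (a' : forall l, 'I_(rk b' l) -> mnm).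
Variables (D : forall l, 'M[S]_(rk b l.+1, rk b l)).
Variables (D' : forall l, 'M[S]_(rk b' l.+1, rk b' l)).
Variable u : mnm.
Arguments a : clear implicits.
Arguments a' : clear implicits.
Hypotheses (resD : is_monres J a D) (resD' : is_monres J' a' D').
Hypothesis colonJ : forall m, J' m = J (u + m)%MM.

(** Multiplication by [x^u] carries the colon ideal [J'] into [J], hence lifts to a chain map.
    Homogeneous lifts make it preserve multidegrees once those of the source are shifted by [u]. *)
Lemma cone_map : exists phi : forall l, 'M[S]_(rk b' l, rk b l),
  [/\ phi 0%N = (xmon q u : S)%:M,
      forall l, D' l *m phi l = phi l.+1 *m D l &
      forall l, mhom_mx (fun i => a' l i + u)%MM (a l) (phi l)].
Proof.
have [a0 homD DD exD augD] := resD; have [a'0 homD' DD' exD' augD'] := resD'.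
pose ok l (f : 'M[S]_(rk b' l, rk b l)) :=
  (forall i, exists x, row i (D' l *m f) = x *m D l) /\
  mhom_mx (fun i => a' l i + u)%MM (a l) f.
have homu l : mhom_mx (fun i => a' l.+1 i + u)%MM (fun i => a' l i + u)%MM (D' l).
  by move=> i j m /homD' <-; rewrite addmA.
have ok0 : ok 0%N (xmon q u : S)%:M.
  split=> [i|i j m].
    have -> : row i (D' 0%N *m (xmon q u : S)%:M) = (D' 0%N i 0 * xmon q u : S)%:M.
      apply/rowP => j; rewrite !mxE (bigD1 0) //= big1 ?addr0 => [|l]; last first.
        by rewrite (ord1 l).
      by rewrite !mxE (ord1 j) eqxx.
    have [x ex] : exists x, (D' 0%N i 0 * xmon q u : S)%:M = x *m D 0%N; last by exists x.
    apply/augD => m; rewrite converse_mulE => /xcoefM_neq0[x [y [ux Dy ->]]].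
    (* The entries of [D' 0] lie in the ideal of [J'], being the images of basis vectors. *)
    have /(iffLR (augD' _))/(_ y Dy) :
        exists w : 'rV_(b' 0%N), ((D' 0%N i 0)%:M : 'M_1) = w *m D' 0%N.
      exists (delta_mx 0 i).
      by rewrite -rowE; apply/rowP => j; rewrite !mxE (ord1 j) eqxx.
    rewrite colonJ; move: ux; rewrite xcoef_xmon.
    by case: (eqVneq u x) => [->|]; rewrite ?eqxx.
  rewrite !ord1 mxE eqxx a'0 a0 mulr1n xcoef_xmon add0m addm0.
  by case: (eqVneq u m) => [->|]; rewrite ?eqxx.
have step l (f : {f | @ok l f}) : exists f' : {f | @ok l.+1 f},
    D' l *m sval f = sval f' *m D l.
  case: f => f [im hf] /=.
  have [f' ef' hf'] := mhom_lift (homD l) (mhom_mxM (homu l) hf) im.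
  suff okf' : @ok l.+1 f' by exists (exist _ f' okf').
  split=> // i; apply: exD.
  by rewrite -row_mul -mulmxA -ef' mulmxA DD' mul0mx row0.
pose next l f := sval (constructive_indefinite_description _ (@step l f)).
pose F := nat_rect (fun l => {f | @ok l f}) (exist _ _ ok0) next.
exists (fun l => sval (F l)); split=> // [l|l].
  exact: (svalP (constructive_indefinite_description _ (@step l (F l)))).
by case: (svalP (F l)).
Qed.

(** [rk cone_rk l.+1] unfolds to [rk b l.+1 + rk b' l], so the block matrices of the cone are well
    typed by conversion. *)
Definition cone_rk l := (b l + rk b' l)%N.

Variable phi : forall l, 'M[S]_(rk b' l, rk b l).
Hypothesis phi0 : phi 0%N = (xmon q u : S)%:M.
Hypothesis phiD : forall l, D' l *m phi l = phi l.+1 *m D l.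
Hypothesis phi_hom : forall l, mhom_mx (fun i => a' l i + u)%MM (a l) (phi l).

Definition cone_deg l : 'I_(rk cone_rk l) -> mnm :=
  match l with
  | 0 => fun _ => 0%MM
  | l'.+1 => fun i => match split i with
                      | inl i' => a l'.+1 i'
                      | inr i' => (a' l' i' + u)%MM
                      end
  end.

(** In degree 0 the cone is just [R], whence a single column block at the bottom. The sign of [D']
    makes consecutive differentials compose to zero. *)
Definition cone_diff l : 'M[S]_(rk cone_rk l.+1, rk cone_rk l) :=
  match l with
  | 0 => col_mx (D 0) (phi 0)
  | l'.+1 => block_mx (D l'.+1) 0 (phi l'.+1) (- D' l')
  end.

Lemma cone_diff_hom l : mhom_mx (@cone_deg l.+1) (@cone_deg l) (cone_diff l).
Proof.
have [a0 homD _ _ _] := resD; have [a'0 homD' _ _ _] := resD'.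
case: l => [|l] i j m.
  rewrite /= mxE; case: (split i) => i'.
    by move=> /homD <-; rewrite a0.
  by move=> /phi_hom <-; rewrite a0.
rewrite /= mxE; case: (split i) => i'; rewrite mxE; case: (split j) => j'.
- exact: homD.
- by rewrite mxE; apply: mhom0.
- exact: phi_hom.
by rewrite mxE => /mhomN-/(_ _ _ (homD' _ _ _)) <-; rewrite addmA.
Qed.

(** The second component [y] of a cycle is a boundary [w D']; removing it leaves a cycle of [D]. *)
Lemma cone_exact l (v : 'rV[S]_(rk cone_rk l.+1)) :
  v *m cone_diff l = 0 -> exists w, v = w *m cone_diff l.+1.
Proof.
have [a0 homD DD exD augD] := resD; have [a'0 homD' DD' exD' augD'] := resD'.
rewrite -(hsubmxK v); set x := lsubmx v; set y := rsubmx v => e.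
have e1 : x *m D l + y *m phi l = 0.
  case: l v x y e => [|l] v x y; first by rewrite /= mul_row_col.
  by rewrite /= mul_row_block => /(congr1 lsubmx); rewrite row_mxKl linear0.
have [w ew] : exists w, y = w *m D' l.
  case: l v x y e e1 => [|l] v x y.
    (* In the lowest degree there is no cycle condition for [D']; instead [e1] puts [x^u y] in the
       ideal of [J], so [y] lies in that of [J']. *)
    rewrite /= phi0 => _ e1.
    have ye : y = (y 0 0)%:M by rewrite [LHS]mx11_scalar.
    rewrite ye; apply/augD' => m ym; rewrite colonJ.
    apply: (iffLR (augD (y 0 0 * xmon q u : S))).
      exists (- x); rewrite mulNmx; apply/eqP; rewrite -addr_eq0 addrC -e1 ye; apply/eqP.
      congr (_ + _); apply/rowP => j; rewrite mul_scalar_mx !mxE (ord1 j) eqxx.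
      by rewrite !mulr1n.
    rewrite converse_mulE xcoef_xmonM mulrI_eq0; first exact: ym.
    exact/mulrI/qcoef_unit.
  rewrite /= mul_row_block => /(congr1 rsubmx); rewrite row_mxKr linear0.
  by rewrite mulmx0 add0r mulmxN => /eqP; rewrite oppr_eq0 => /eqP /exD'.
(* Subtracting the boundary of [(0, - w)] from [(x, y)] leaves [(x + w phi, 0)]. *)
have [|z ez] := exD l (x + w *m phi l.+1).
  by rewrite mulmxDl -mulmxA -phiD mulmxA -ew.
by exists (row_mx z (- w)); rewrite /= mul_row_block -ez mulmx0 add0r mulNmx addrK
  mulmxN mulNmx opprK ew.
Qed.

Lemma cone_monres :
  is_monres (fun m => (u <= m)%MM || J m) cone_deg cone_diff.
Proof.
have [a0 homD DD exD augD] := resD; have [a'0 homD' DD' exD' augD'] := resD'.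
split=> [//||l|l v|f]; [exact: cone_diff_hom| |exact: cone_exact|].
  case: l => [|l] /=.
    rewrite mul_block_col mul0mx addr0 mulNmx; move: (DD 0%N) (phiD 0) => /= -> ->.
    by rewrite subrr col_mx0.
  rewrite mulmx_block !mul0mx !mulmx0 !addr0 !add0r !mulNmx !mulmxN.
  move: (DD l.+1) (DD' l) (phiD l.+1) => /= -> -> ->.
  by rewrite subrr !oppr0 block_mx0.
split=> [[w]|H].
  rewrite -(hsubmxK w) /= mul_row_col phi0 => e m.
  have -> : f = (lsubmx w *m D 0%N) 0 0 + rsubmx w 0 0 * xmon q u.
    move/(congr1 (fun A : 'M[S]_1 => A 0 0)): e; rewrite mxE eqxx mulr1n => ->.
    rewrite mxE; congr (_ + _).
    by rewrite mxE big_ord_recl big_ord0 addr0 [X in _ * X]mxE eqxx mulr1n.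
  rewrite xcoefD.
  case: (eqVneq (xcoef m ((lsubmx w *m D 0%N) 0 0 : R)) 0) => [->|ne _].
    rewrite add0r converse_mulE => /xcoefM_neq0[x [y [ux _ ->]]].
    move: ux; rewrite xcoef_xmon; case: (eqVneq u x) => [->|]; rewrite ?eqxx //.
    by rewrite lem_addr.
  apply/orP; right; apply: (iffLR (augD _)) ne; exists (lsubmx w).
  by apply/rowP => j; rewrite mxE (ord1 j) eqxx.
(* The monomials of [f] not divisible by [x^u] must lie in [J]; the others factor as [x^u g] and
   give the second component. *)
have [x ex] : exists x : 'rV_(b 0%N),
    ((trunc (fun m => ~~ (u <= m)%MM) (f : R) : S)%:M : 'M_1) = x *m D 0%N.
  by apply/augD => m /trunc_neq0/andP[num /H]; rewrite (negbTE num).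
have [g eg] : exists g, trunc (fun m => u <= m)%MM (f : R) = xmon q u * g.
  by apply: xmonM_factor => // m /trunc_neq0/andP[].
exists (row_mx x (g : S)%:M); rewrite /= mul_row_col -ex phi0 -scalar_mxM -raddfD.
congr (_%:M); rewrite converse_mulE -eg addrC [LHS](truncD (fun m => u <= m)%MM).
by [].
Qed.

End Cone.

(** [l0] is the first degree whose differential must have no constant terms: [0] for the Koszul
    resolutions, [1] for the stable ideal, as [D 0] may have a unit entry when the ideal is all of
    [R]. [Q] constrains the total degrees of basis elements. *)
Definition has_monres l0 (J : pred mnm) b (Q : nat -> nat -> Prop) : Prop :=
  exists a D, [/\ @is_monres J b a D,
    forall l, (l0 <= l)%N -> forall i j, xcoef 0%MM (D l i j : R) = 0 &
    forall l i, Q l (mdeg (a l i))].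

Lemma has_monres_ext l0 (J J' : pred mnm) b (Q Q' : nat -> nat -> Prop) :
    has_monres l0 J b Q -> J =1 J' -> (forall l e, Q l e -> Q' l e) ->
  has_monres l0 J' b Q'.
Proof.
move=> [a [D [[a0 hD DD ex aug] min deg]]] eJ QQ.
exists a, D; split=> //; last by move=> l i; apply/QQ.
by split=> // f; split=> [/aug H m /H|H]; [rewrite eJ|apply/aug => m /H; rewrite eJ].
Qed.

Lemma has_monres0 Q : Q 0%N 0%N -> has_monres 0 pred0 (fun=> 0%N) Q.
Proof.
move=> Q0; exists (fun l _ => 0%MM), (fun l => 0); split.
- split=> //.
  + by move=> l i j; rewrite mxE; apply: mhom0.
  + by move=> l; rewrite mulmx0.
  + by move=> l v _; exists 0; rewrite mulmx0; apply/rowP => - [].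
  move=> f; split=> [[w]|H].
    rewrite mulmx0 => e m; have -> : f = (0 : R); last by rewrite xcoef0 eqxx.
    by move/(congr1 (fun A : 'M[S]_1 => A 0 0)): e; rewrite !mxE eqxx mulr1n.
  exists 0; rewrite mulmx0; suff -> : f = 0 by rewrite raddf0.
  apply: (@xcoefP _ _ q) => m; rewrite xcoef0; apply/eqP.
  by apply: contraT => /H.
- by move=> l _ i j; rewrite mxE; apply: xcoef0.
- by case=> [|l] [] //; rewrite mdeg0.
Qed.

(** A basis element of degree [l - 1] in the second resolution enters degree [l] of the cone with
    total degree [mdeg u + l - 1]; writing [e.+1] avoids truncated subtraction. *)
Lemma has_monres_cone l0 (J J' : pred mnm) b b' Q u :
    has_monres l0 J b Q -> has_monres 0 J' b' (fun l e => e = l) ->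
    (forall m, J' m = J (u + m)%MM) ->
    (forall l e, (l0 <= l)%N -> Q l e -> (e < mdeg u + l)%N) ->
  has_monres l0 (fun m => (u <= m)%MM || J m) (cone_rk b b')
    (fun l e => Q l e \/ e.+1 = (mdeg u + l)%N).
Proof.
move=> [a [D [res min deg]]] [a' [D' [res' min' deg']]] colon Qlt.
have [phi [phi0 phiD phi_hom]] := cone_map res res' colon.
exists (cone_deg a a' u), (cone_diff D D' phi); split.
- exact: (cone_monres res res' colon phi0 phiD phi_hom).
- move=> l l0l i j.
  (* A constant term would link basis elements of equal total degree, but it is [mdeg u + l] in the
     source and smaller in the target. *)
  have phi_min i' j' : xcoef 0%MM (phi l i' j' : R) = 0.
    apply/eqP; apply: contraT => /phi_hom/(congr1 mdeg).
    rewrite add0m mdegD deg' => e; have := Qlt _ _ l0l (deg l j').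
    by rewrite e addnC ltnn.
  case: l l0l i j phi_min => [|l] l0l i j phi_min /=.
    by rewrite mxE; case: split => i' //; apply: min.
  rewrite mxE; case: (split i) => i'; rewrite mxE; case: (split j) => j' //.
  + exact: min.
  + by rewrite mxE; apply: xcoef0.
  + by rewrite mxE; apply: etrans (xcoefN _ _) _; rewrite min' ?oppr0.
case=> [|l] i /=.
  by left; have [a0 _ _ _ _] := res; have := deg 0%N 0; rewrite a0.
by case: (split i) => i'; [left; apply: deg|right; rewrite mdegD deg' addnC addnS].
Qed.

Fixpoint koszul_rk m : nat -> nat :=
  if m is m'.+1 then cone_rk (koszul_rk m') (koszul_rk m') else fun=> 0%N.

Lemma rk_koszul m l : rk (koszul_rk m) l = 'C(m, l).
Proof.
elim: m l => [|m IH] [|l] //=.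
by rewrite /cone_rk -/(rk _ l.+1) !IH binS.
Qed.

(** The colon of the first [m] variables by the next one is unchanged, so each stage is the cone of
    the previous resolution with itself. *)
Lemma has_monres_koszul m : (m <= n)%N ->
  has_monres 0 (fun w => [exists i : 'I_n, (i < m)%N && (0 < w i)%N])
    (koszul_rk m) (fun l e => e = l).
Proof.
elim: m => [_|m IH mn].
  apply: (has_monres_ext (has_monres0 (Q := fun l e => e = l) _)) => // w.
  by symmetry; apply/existsP => - [].
pose i0 := Ordinal mn; have res := IH (ltnW mn).
apply: (has_monres_ext (has_monres_cone (u := U_(i0)%MM) res res _ _))
  => [w|l e _ ->|w|l e].
- apply: eq_existsb => i; rewrite mnmDE mnm1E.
  by case: eqVneq => // <-; rewrite /= ltnn.
- by rewrite mdeg1.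
- apply/idP/existsP => [/orP[|/existsP[i /andP[im wi]]]|[i /andP[]]].
  - by rewrite lep1mP -lt0n => wi; exists i0; rewrite ltnSn.
  - by exists i; rewrite wi ltnW.
  rewrite ltnS leq_eqVlt => /orP[/eqP im|im] wi; apply/orP; [left|right].
    by rewrite lep1mP -lt0n; have -> : i0 = i by apply: val_inj.
  by apply/existsP; exists i; rewrite im.
by case=> //; rewrite mdeg1 add1n => - [].
Qed.

(* Entry [l] is the rank in degree [l + 1] for [R / I], so in degree [l] for [I]. *)
Fixpoint ek_rk (s : seq mnm) : nat -> nat :=
  if s is u :: s' then cone_rk (ek_rk s') (koszul_rk (maxv u - 1))
  else fun=> 0%N.

Lemma ek_rkE s l : ek_rk s l = (\sum_(u <- s) 'C(maxv u - 1, l))%N.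
Proof.
elim: s => [|u s IH]; first by rewrite big_nil.
by rewrite big_cons /= /cone_rk IH rk_koszul addnC.
Qed.

Lemma maxv_le (u : mnm) : (maxv u - 1 <= n)%N.
Proof.
rewrite /maxv leq_subLR geq_max; apply/andP; split=> //.
by apply/bigmax_leqP => i _; rewrite add1n ltnS ltnW.
Qed.

(** The degree bound is what survives the induction: since no earlier generator exceeds [u] in
    degree, it yields the strict inequality that keeps the cone minimal. *)
Lemma has_monres_linear_quotients s : linear_quotients s ->
  has_monres 1 (fun m => has (fun v => v <= m)%MM s) (ek_rk s)
    (fun l e => l = 0%N \/ exists2 v, v \in s & (e < mdeg v + l)%N).
Proof.
elim: s => [|u s IH] H.
  have [|a [D [res min deg]]] := @has_monres0 (fun l e => l = 0%N); first by [].
  exists a, D; split=> // [l _|l i]; last by left; apply: deg.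
  exact: min.
have [degu colon] := H [::] u s erefl.
have res : has_monres 1 _ _ _ := IH (fun t v s' e => H (u :: t) v s' (congr1 (cons u) e)).
apply: (has_monres_ext (has_monres_cone (u := u) res
  (has_monres_koszul (maxv_le u)) _ _)).
- by move=> m; rewrite colon.
- move=> l e l1 [l0|[v vs lt]]; first by rewrite l0 in l1.
  by apply: leq_trans lt _; rewrite leq_add2r degu.
- by [].
move=> l e [[->|[v vs lt]]|e1]; [by left| |]; right.
  by exists v; rewrite // inE vs orbT.
by exists u; rewrite ?inE ?eqxx // -e1.
Qed.

End MonomialResolutions.

(** * Colon ideals of stable ideals *)

Section StableGenerators.
Variable n : nat.
Implicit Types (u v w m : 'X_{1..n}).

Lemma maxv_ge w (i : 'I_n) : (0 < w i)%N -> (i < maxv w)%N.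
Proof.
by move=> wi; rewrite /maxv leq_max (bigmax_sup i) ?orbT.
Qed.

Lemma maxv_attained w (i : 'I_n) : (0 < w i)%N ->
  exists2 j : 'I_n, j.+1 = maxv w & (0 < w j)%N.
Proof.
move=> wi.
case: (@arg_maxnP _ i (fun i => 0 < w i)%N (fun i : 'I_n => i.+1) wi) => j wj jmax.
exists j => //; apply/eqP; rewrite eqn_leq maxv_ge //= geq_max /=.
by apply/bigmax_leqP.
Qed.

Lemma maxv_gt1 w : (1 < maxv w)%N -> exists i, (0 < w i)%N.
Proof.
move=> w1; apply/existsP; apply: contraTT w1 => /existsPn w0.
by rewrite /maxv big_pred0 // => i; apply/negbTE/w0.
Qed.

(** Stated additively because subtraction of exponents is truncated. *)
Lemma exchangeE w (i j l : 'I_n) : (0 < w j)%N ->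
  (((U_(i) + w) - U_(j))%MM l + (j == l) = (i == l) + w l)%N.
Proof.
by move=> wj; rewrite mnmBE mnmDE !mnm1E; case: (eqVneq j l) => [<-|]; lia.
Qed.

Lemma exchangeK w (i j : 'I_n) : (0 < w j)%N ->
  ((U_(i) + w) - U_(j) + U_(j) = U_(i) + w)%MM.
Proof. by move=> wj; rewrite submK // lep1mP mnmDE -lt0n ltn_addl. Qed.

Lemma mdeg_exchange w (i j : 'I_n) : (0 < w j)%N ->
  mdeg ((U_(i) + w) - U_(j))%MM = mdeg w.
Proof.
by move=> /(exchangeK i) /(congr1 mdeg); rewrite !mdegD !mdeg1 addnC => - [].
Qed.

Lemma mnmwgt_exchange w (i j : 'I_n) : (0 < w j)%N -> (i < j)%N ->
  (mnmwgt ((U_(i) + w) - U_(j))%MM < mnmwgt w)%N.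
Proof.
by move=> /(exchangeK i) /(congr1 (@mnmwgt n)); rewrite !mnmwgtD !mnmwgt1; lia.
Qed.

Lemma mdeg_lepm u v : (u <= v)%MM -> (mdeg v <= mdeg u)%N -> u = v.
Proof.
move=> /submK <-; rewrite mdegD -[X in (_ <= X)%N]add0n leq_add2r leqn0 mdeg_eq0.
by move=> /eqP ->; rewrite add0m.
Qed.

(** Sorting by this relation lists the generators added last first, as [linear_quotients] expects.
    The weight [mnmwgt] drops under exchanges. *)
Definition gen_after u v : bool :=
  (mdeg v < mdeg u)%N || ((mdeg v == mdeg u) && (mnmwgt v <= mnmwgt u)%N).

Lemma gen_after_trans : transitive gen_after.
Proof. by move=> v u w; rewrite /gen_after; lia. Qed.

Lemma gen_after_total : total gen_after.
Proof. by move=> u v; rewrite /gen_after; lia. Qed.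

Variable G : seq 'X_{1..n}.
Let inG w := has (fun v => v <= w)%MM G.

Hypothesis G_stable : forall w, inG w -> forall i j : 'I_n,
  j.+1 = maxv w -> (i.+1 < maxv w)%N -> inG ((U_(i) + w) - U_(j))%MM.

(* Repeatedly exchanging the last variable of [v] for a smaller variable that is
   missing from [v] pushes [v] below [u] inside the ideal. *)
Lemma stable_descent u v : inG v -> (mdeg v <= mdeg u)%N ->
    (forall i : 'I_n, (i < maxv u - 1)%N -> (v i <= u i)%N) ->
  exists v', [/\ inG v', (v' <= u)%MM, mdeg v' = mdeg v &
    v' = v \/ (mnmwgt v' < mnmwgt v)%N].
Proof.
have [N] := ubnP (mnmwgt v); elim: N v => // N IH v ltN Gv duv low.
have [vu|] := boolP (v <= u)%MM; first by exists v; split=> //; left.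
(* [v] exceeds [u] at some [j0], necessarily not before the last variable of [u], hence also at the
   last variable [j] of [v]; comparing degrees then yields an [i] with [v i < u i]. *)
case/forallPn => /= j0; rewrite -ltnNge => uv0.
have m_j0 : (maxv u - 1 <= j0)%N.
  by rewrite leqNgt; apply/negP => /low; rewrite leqNgt uv0.
have [j ej vj] : exists2 j : 'I_n, j.+1 = maxv v & (0 < v j)%N.
  by apply: (@maxv_attained _ j0); apply: leq_ltn_trans uv0.
have j0j : (j0 <= j)%N by rewrite -ltnS ej maxv_ge //; apply: leq_ltn_trans uv0.
have uvj : (u j < v j)%N.
  (* If [u j] is positive then [j <= maxv u - 1 <= j0 <= j]. *)
  case: (posnP (u j)) => [-> //|/maxv_ge uj].
  by have -> : j = j0 by apply: val_inj => /=; lia.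
have [i vui] : exists i, (v i < u i)%N.
  apply/existsP; apply: contraLR uvj => /existsPn H.
  have uv : (u <= v)%MM by apply/mnm_lepP => i; rewrite leqNgt.
  by rewrite (mdeg_lepm uv duv) ltnn.
have im : (i <= maxv u - 1)%N by have := maxv_ge (leq_ltn_trans (leq0n _) vui); lia.
have ij : (i < j)%N.
  rewrite ltn_neqAle (leq_trans im) ?(leq_trans m_j0) // andbT.
  by apply/eqP => /val_inj e; move: vui uvj; rewrite e; lia.
have wlt := mnmwgt_exchange vj ij.
have [|||l lm|v' [Gv' v'u dv' wv']] := IH ((U_(i) + v) - U_(j))%MM.
- exact: leq_trans wlt _.
- by apply: G_stable => //; rewrite -ej ltnS.
- by rewrite mdeg_exchange.
(* Only the exponent at [i] grows, by one, and there [v i < u i]. *)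
- have := exchangeE i l vj; have := low l lm.
  case: (eqVneq i l) => [<-|_] /=; first by lia.
  lia.
exists v'; split=> //; first by rewrite dv' mdeg_exchange.
by right; case: wv' => [->//|lt]; apply: ltn_trans wlt.
Qed.

Hypothesis G_uniq : uniq G.
Hypothesis G_anti : forall u v, u \in G -> v \in G -> (u <= v)%MM -> u = v.

Lemma lepm_anti u v : (u <= v)%MM -> (v <= u)%MM -> u = v.
Proof.
move=> /mnm_lepP uv /mnm_lepP vu; apply/mnmP => i.
by apply/eqP; rewrite eqn_leq uv vu.
Qed.

Lemma inG_le u v : u \in G -> inG v -> (v <= u)%MM -> v = u.
Proof.
move=> uG /hasP[w wG wv] vu; apply: lepm_anti => //.
by rewrite -(G_anti wG uG (lepm_trans wv vu)).
Qed.

(** If an earlier [v] divided [x^(u+m)] with [m] free of the variables before the last one of [u],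
    descent would reach [u] from [v] by lowering the weight, against the order. Conversely, for
    [x_i] before that last variable, a generator dividing the exchange of [u] divides [x_i u] and is
    earlier. *)
Lemma stable_linear_quotients : linear_quotients (sort gen_after G).
Proof.
move=> t u s eG.
have mem v : (v \in G) = (v \in t ++ u :: s) by rewrite -eG mem_sort.
have uG : u \in G by rewrite mem mem_cat inE eqxx orbT.
have : uniq (t ++ u :: s) by rewrite -eG sort_uniq.
rewrite cat_uniq /= => /and3P[_ _ /andP[us _]].
have := sort_sorted gen_after_total G; rewrite eG (sorted_pairwise gen_after_trans).
rewrite pairwise_cat /= => /and3P[/allrelP ts _ /andP[/allP after_s _]].
split=> [v /after_s|m]; first by rewrite /gen_after; lia.
apply/hasP/existsP => [[v vs vum]|[i /andP[im mi]]].
  have vG : v \in G by rewrite mem mem_cat inE vs !orbT.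
  apply/existsP; apply: contraT => /existsPn m0.
  have [|||v' [Gv' v'u dv' wv']] := @stable_descent u v.
  - by apply/hasP; exists v; rewrite ?lepm_refl.
  - by have := after_s _ vs; rewrite /gen_after; lia.
  - move=> i im; move/mnm_lepP/(_ i): vum; rewrite mnmDE.
    by have := m0 i; rewrite im /= lt0n negbK => /eqP ->; rewrite addn0.
  have e := inG_le uG Gv' v'u; rewrite e in dv' wv'.
  case: wv' => [uv|lt]; first by rewrite -uv (negbTE us) in vs.
  by have := after_s _ vs; rewrite /gen_after; lia.
have [j0 uj0] : exists j, (0 < u j)%N by apply: maxv_gt1; lia.
have [j ej uj] := maxv_attained uj0.
have ij : (i < j)%N by lia.
have /hasP[v vG vw] : inG ((U_(i) + u) - U_(j))%MM.
  apply: G_stable => //; last by lia.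
  by apply/hasP; exists u; rewrite ?lepm_refl.
have vu1 : (v <= U_(i) + u)%MM.
  by rewrite -(exchangeK i uj); apply: lepm_trans vw (lem_addr _ _).
exists v; last first.
  apply: lepm_trans vu1 _; apply/mnm_lepP => l; rewrite !mnmDE mnm1E.
  by case: (eqVneq i l) => [<-|]; lia.
(* [v] has smaller degree than [u], or it is the exchange itself, of equal degree and smaller
   weight; so it stands after [u] in the list. *)
have strict : ~~ gen_after v u.
  have [vlt|vge] := ltnP (mdeg v) (mdeg u); first by rewrite /gen_after; lia.
  have -> : v = ((U_(i) + u) - U_(j))%MM by apply: mdeg_lepm; rewrite ?mdeg_exchange.
  by have := mnmwgt_exchange uj ij; rewrite /gen_after mdeg_exchange // ltnn eqxx /=; lia.
move: vG; rewrite mem mem_cat inE => /or3P[vt|/eqP vu|//].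
  by rewrite ts ?inE ?eqxx // in strict.
by rewrite vu /gen_after eqxx leqnn orbT in strict.
Qed.

End StableGenerators.

(** * Counting monomials *)

Lemma fps_frac_unique (p u : {poly int}) (f : nat -> int) : u`_0 = 1 ->
    (forall j, \sum_(i < j.+1) f i * u`_(j - i) = p`_j) ->
  forall j, fps_frac p u j = f j.
Proof.
move=> u0 H j; have [N] := ubnP j; elim: N j => // N IH j; rewrite ltnS => ltj.
have := H j; rewrite -(fps_fracP p j u0) !big_ord_recr /= subnn u0 !mulr1.
rewrite (eq_bigr (fun i : 'I_j => fps_frac p u i * u`_(j - i))); first by move/addrI.
by move=> i _; rewrite IH // (leq_trans (ltn_ord i)).
Qed.

(** Multiplying a power series by [1 - X] takes first differences, so a factor [1 - X] moves from
    the polynomial to the sequence. *)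
Lemma conv_sub1X (f g : nat -> int) (p : {poly int}) j :
    f 0%N = g 0%N -> (forall i, f i.+1 = g i.+1 + f i) ->
  \sum_(i < j.+1) f i * (p * (1 - 'X))`_(j - i) = \sum_(i < j.+1) g i * p`_(j - i).
Proof.
move=> fg0 fg.
have coefE i : (p * (1 - 'X))`_i = p`_i - (if i is i'.+1 then p`_i' else 0).
  by rewrite mulrBr mulr1 coefB coefMX; case: i.
under eq_bigr do rewrite coefE mulrBr.
rewrite sumrB [X in X - _]big_ord_recl [X in _ - X]big_ord_recr /= subnn mulr0 addr0.
rewrite [RHS]big_ord_recl fg0 -addrA; congr (_ + _).
rewrite -sumrB; apply: eq_bigr => i _ /=.
have -> : (j - i = (j - i.+1).+1)%N by have := ltn_ord i; lia.
rewrite /bump /= add1n fg; ring.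
Qed.

Section Counting.
Variable n : nat.
Implicit Types (u v w : 'X_{1..n}) (m : nat).

Definition mons_deg j : seq 'X_{1..n} :=
  [seq w <- map val (enum {: 'X_{1..n < j.+1}}) | mdeg w == j].

Lemma mem_mons_deg j w : (w \in mons_deg j) = (mdeg w == j).
Proof.
rewrite mem_filter andbC; apply/andb_idl => /eqP e.
have lt : (mdeg w < j.+1)%N by rewrite e.
by apply/mapP; exists (BMultinom lt); rewrite ?mem_enum.
Qed.

Lemma mons_deg_uniq j : uniq (mons_deg j).
Proof. by rewrite filter_uniq // map_inj_uniq ?enum_uniq //; apply: val_inj. Qed.

(** With [m = maxv u - 1] these monomials are the piece of a Stanley decomposition attached to
    [u]. *)
Definition tail_mul u m w := (u <= w)%MM && [forall i : 'I_n, (i < m)%N ==> (w i == u i)].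

Definition tail_count u m j := count (tail_mul u m) (mons_deg j).

Lemma tail_count_n u j : tail_count u n j = (mdeg u == j).
Proof.
rewrite /tail_count (@eq_count _ _ (pred1 u)).
  by rewrite count_uniq_mem ?mons_deg_uniq // mem_mons_deg.
move=> w /=; apply/andP/eqP => [[_ /forallP H]|->].
  by apply/mnmP => i; have := H i; rewrite ltn_ord => /eqP.
by split; [exact: lepm_refl|apply/forallP => i; rewrite eqxx implybT].
Qed.

Lemma tail_mulS u m (mn : (m < n)%N) w :
  tail_mul u m.+1 w = tail_mul u m w && (w (Ordinal mn) == u (Ordinal mn)).
Proof.
rewrite /tail_mul -andbA; congr (_ && _).
apply/forallP/andP => [H|[/forallP H e] i].
  split; last by have := H (Ordinal mn); rewrite ltnSn.
  by apply/forallP => i; apply/implyP => im; apply: (implyP (H i)); apply: ltnW.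
apply/implyP; rewrite ltnS leq_eqVlt => /orP[/eqP im|]; last exact/implyP.
by have -> : i = Ordinal mn by apply: val_inj.
Qed.

Lemma tail_count0 u m : (m < n)%N -> tail_count u m 0 = tail_count u m.+1 0.
Proof.
move=> mn; apply: eq_in_count => w; rewrite mem_mons_deg mdeg_eq0 => /eqP ->.
rewrite tail_mulS andbC.
case: (boolP (tail_mul u m 0)) => [/andP[/mnm_lepP H _]|_]; last by rewrite andbF.
by have := H (Ordinal mn); rewrite mnm0E leqn0 => /eqP ->.
Qed.

(** A tail multiple either has the exponent of [u] at index [m], or remains a tail multiple after
    division by that variable. On generating functions this is [T_m (1 - t) = T_(m+1)]. *)
Lemma tail_countS u m j : (m < n)%N ->
  tail_count u m j.+1 = (tail_count u m.+1 j.+1 + tail_count u m j)%N.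
Proof.
move=> mn; pose i0 := Ordinal mn.
have split (s : seq 'X_{1..n}) (P Q : pred 'X_{1..n}) :
    count P s = (count (predI Q P) s + count (predI (predC Q) P) s)%N.
  by rewrite -!count_filter count_predC size_filter.
rewrite /tail_count (split _ _ (fun w => w i0 == u i0)); congr (_ + _)%N.
  by apply: eq_count => w; rewrite /= (tail_mulS u mn) andbC.
rewrite -!size_filter -[RHS](size_map (fun w => U_(i0) + w)%MM).
apply: perm_size; apply: uniq_perm.
- exact/filter_uniq/mons_deg_uniq.
- by rewrite map_inj_uniq => [|x y /addmI //]; apply/filter_uniq/mons_deg_uniq.
move=> w; rewrite mem_filter mem_mons_deg /=; apply/idP/mapP => [|[w' + ->]].
  case/andP=> /andP[ne /andP[uw /forallP low]] dw.
  have uw0 : (u i0 < w i0)%N by rewrite ltn_neqAle eq_sym ne; apply/mnm_lepP.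
  have w0 : (U_(i0) <= w)%MM by rewrite lep1mP -lt0n (leq_ltn_trans _ uw0).
  exists (w - U_(i0))%MM; last by rewrite addmC submK.
  rewrite mem_filter mem_mons_deg -(eqn_add2r (mdeg U_(i0))) -mdegD submK //.
  rewrite mdeg1 addn1 dw andbT; apply/andP; split.
    apply/mnm_lepP => i; rewrite mnmBE mnm1E.
    by case: (eqVneq i0 i) => [<-|_]; [lia|rewrite subn0; apply/mnm_lepP].
  apply/forallP => i; apply/implyP => im; rewrite mnmBE mnm1E.
  case: (eqVneq i0 i) im => [<-|_ im]; first by rewrite ltnn.
  by rewrite subn0; apply: (implyP (low i)).
rewrite mem_filter mem_mons_deg => /andP[/andP[uw /forallP low] /eqP dw].
rewrite mdegD mdeg1 dw add1n eqxx andbT mnmDE mnm1E eqxx; apply/andP; split.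
  by move/mnm_lepP/(_ i0): uw; lia.
apply/andP; split; first by apply: lepm_trans uw (lem_addl _ _).
apply/forallP => i; apply/implyP => im; rewrite mnmDE mnm1E.
case: (eqVneq i0 i) im => [<-|_ im]; first by rewrite ltnn.
by apply: (implyP (low i)).
Qed.

Lemma fps_tail_count u m j : (m <= n)%N ->
  fps_frac 'X^(mdeg u) ((1 - 'X) ^+ (n - m)) j = (tail_count u m j)%:Z.
Proof.
move=> mn; apply: (fps_frac_unique (f := fun j => (tail_count u m j)%:Z)).
  rewrite -horner_coef0 horner_exp !hornerE expr1n //.
(* [s] is the number of free variables; for [s = 0] only [u] itself is counted. *)
have H s : (s <= n)%N -> forall j, \sum_(i < j.+1)
    (tail_count u (n - s) i)%:Z * ((1 - 'X) ^+ s : {poly int})`_(j - i) =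
    ('X^(mdeg u) : {poly int})`_j.
  elim: s => [|s IH] sn {}j.
    rewrite expr0 subn0 big_ord_recr /= subnn coef1 mulr1 big1 ?add0r => [|i _].
      by rewrite tail_count_n coefXn eq_sym; case: eqP.
    by rewrite coef1 subn_eq0 leqNgt ltn_ord mulr0.
  have e : (n - s)%N = (n - s.+1).+1 by lia.
  have lt : (n - s.+1 < n)%N by lia.
  rewrite -(IH (ltnW sn) j) exprSr.
  apply: (conv_sub1X (f := fun j => (tail_count u (n - s.+1) j)%:Z)
                     (g := fun j => (tail_count u (n - s) j)%:Z)) => [|i].
    by rewrite e tail_count0.
  by rewrite e tail_countS.
by move=> {}j; have := H _ (leq_subr m n) j; rewrite subKn.
Qed.

(** By the colon condition, a multiple of [u] avoids the other generators of the list exactly when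
    its quotient by [u] has no variable before the last one of [u]. *)
Lemma count_linear_quotients (s : seq 'X_{1..n}) j : linear_quotients s ->
  count (fun w => has (fun v => v <= w)%MM s) (mons_deg j) =
  (\sum_(u <- s) tail_count u (maxv u - 1) j)%N.
Proof.
elim: s => [|u s IH] H; first by rewrite big_nil count_pred0.
have [_ colon] := H [::] u s erefl.
rewrite big_cons -IH => [|t v s' e]; last by apply: (H (u :: t)); rewrite e.
rewrite /tail_count -count_predUI [X in (_ + X)%N](@eq_count _ _ pred0).
  rewrite count_pred0 addn0; apply: eq_count => w /=.
  rewrite /tail_mul; case: (boolP (u <= w)%MM) => //= uw.
  case: (boolP (has _ s)); rewrite ?orbT // orbF => hasN; symmetry.
  apply/forallP => i; apply/implyP => im; apply: contraNT hasN => ne.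
  rewrite -(submK uw) addmC colon; apply/existsP; exists i; rewrite im mnmBE subn_gt0.
  by rewrite ltn_neqAle eq_sym ne; apply/mnm_lepP.
move=> w /=; apply/negbTE/negP => /andP[/andP[uw /forallP low]].
rewrite -(submK uw) addmC colon => /existsP[i /andP[im]]; rewrite mnmBE subn_gt0.
by have := low i; rewrite im /= => /eqP ->; rewrite ltnn.
Qed.

End Counting.

Lemma wdeg_std n (d : 'I_n -> nat) w : (forall i, d i = 1%N) -> wdeg d w = mdeg w.
Proof. by move=> d1; rewrite mdegE; apply: eq_bigr => i _; rewrite d1 mul1n. Qed.

(** * Monomial bases of the graded components *)

Section ComponentRank.
Variables (n : nat) (k : comUnitRingType) (q : 'I_n -> 'I_n -> k).
Local Notation R := (skewpoly q).

Lemma component_rank_count (d : 'I_n -> nat) (I : R -> Prop)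
    (M : pred 'X_{1..n}) j : (forall i, d i = 1%N) ->
    (forall f, I f <-> forall w, xcoef w f != 0 -> M w) ->
  component_rank d I j (count M (mons_deg n j)).
Proof.
move=> d1 IM; rewrite -size_filter; set s := filter _ _.
have wdegE w := wdeg_std w d1.
have s_uniq : uniq s by apply/filter_uniq/mons_deg_uniq.
have memsP w : (w \in s) = M w && (mdeg w == j) by rewrite mem_filter mem_mons_deg.
exists (fun i => xmon q (tnth (in_tuple s) i)); split=> [i|f If homf].
  have := mem_tnth i (in_tuple s); rewrite memsP => /andP[Mi /eqP di].
  split; first apply/IM.
    by move=> w; rewrite xcoef_xmon; case: (eqVneq (tnth _ i) w) => [<-|]; rewrite ?eqxx.
  move=> w; rewrite xcoef_xmon wdegE -di.
  by case: (eqVneq (tnth _ i) w) => [<-|]; rewrite ?eqxx.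
have coefE (c : {ffun 'I_(size s) -> k}) i :
    xcoef (tnth (in_tuple s) i) (\sum_i c i *: xmon q (tnth (in_tuple s) i)) = c i.
  rewrite xcoef_sum (bigD1 i) //= xcoefZ xcoef_xmon eqxx mulr1 big1 ?addr0 // => i' ne.
  rewrite xcoefZ xcoef_xmon; case: eqP => [e|]; last by rewrite mulr0.
  by move: ne; rewrite (tuple_uniqP (in_tuple s) s_uniq _ _ e) eqxx.
exists [ffun i => xcoef (tnth (in_tuple s) i) f]; split=> [|c ->]; last first.
  by apply/ffunP => i; rewrite ffunE coefE.
apply: xcoefP => w; have [ws|nws] := boolP (w \in s).
  have [i ->] : exists i, w = tnth (in_tuple s) i by apply/tnthP.
  by rewrite coefE ffunE.
rewrite xcoef_sum big1 => [|i _]; last first.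
  rewrite xcoefZ xcoef_xmon; case: eqP => [e|]; last by rewrite mulr0.
  by rewrite -e mem_tnth in nws.
apply/eqP; apply: contraNT nws => fw; rewrite memsP (iffLR (IM f) If) //=.
by have := homf w fw; rewrite wdegE => - [->].
Qed.

End ComponentRank.

(** * Conclusion *)

Section RowModules.
Variable R : nzRingType.

Fact row_basisP r (v : 'rV[R^c]_r) :
  exists! c : {ffun 'I_r -> R^c}, v = \sum_i c i *: delta_mx 0 i.
Proof.
exists [ffun i => v 0 i]; split=> [|c ->].
  by rewrite {1}[v]row_sum_delta; apply: eq_bigr => i _; rewrite ffunE.
apply/ffunP => i; rewrite ffunE summxE (bigD1 i) //= big1 => [|j ne].
  by rewrite !mxE !eqxx mulr1 addr0.
by rewrite !mxE eqxx [i == j]eq_sym (negbTE ne) mulr0.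
Qed.

Definition row_gfree r (deg : 'I_r -> int) : gfree R :=
  @GFree R 'rV[R^c]_r r (delta_mx 0) deg (@row_basisP r).

(** The augmentation lands in the regular module instead of one-by-one matrices. *)
Definition mulmx_entry r (D : 'M[R^c]_(r, 1)) (v : 'rV[R^c]_r) : rreg R :=
  (v *m D) 0 0.

Fact mulmx_entry_linear r (D : 'M[R^c]_(r, 1)) : linear (mulmx_entry D).
Proof. by move=> c v w; rewrite /mulmx_entry mulmxDl -scalemxAl !mxE. Qed.

HB.instance Definition _ r D := GRing.isLinear.Build R^c _ _ *:%R
  (@mulmx_entry r D) (@mulmx_entry_linear r D).

End RowModules.

(** * From multigraded to graded resolutions *)

Section Packaging.
Variables (n : nat) (k : comUnitRingType) (q : 'I_n -> 'I_n -> k).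
Local Notation R := (skewpoly q).
Local Notation S := (R^c)%type.
Variable d : 'I_n -> nat.

Lemma wdegD u v : wdeg d (u + v)%MM = (wdeg d u + wdeg d v)%N.
Proof. by rewrite /wdeg -big_split; apply: eq_bigr => i _; rewrite mnmDE mulnDr. Qed.

Lemma whom_sum j (T : Type) (s : seq T) (F : T -> R) :
  (forall i, whom d j (F i)) -> whom d j (\sum_(i <- s) F i).
Proof.
move=> H w; rewrite xcoef_sum; apply: contraNeq => ne.
by rewrite big1 // => i _; apply/eqP; apply: contraNT ne => /H ->.
Qed.

Lemma whom_mulmx p r (a : 'I_p -> 'X_{1..n}) (c : 'I_r -> 'X_{1..n})
    (D : 'M[S]_(p, r)) (v : 'rV[S]_p) j l : mhom_mx a c D ->
  (forall i, whom d (j - (wdeg d (a i))%:Z) (v 0 i : R)) ->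
  whom d (j - (wdeg d (c l))%:Z) ((v *m D) 0 l : R).
Proof.
move=> hD hv; rewrite mxE; apply: whom_sum => i w.
rewrite converse_mulE => /xcoefM_neq0[x [y [/hD e /hv ey ->]]].
by rewrite wdegD; move: ey; rewrite -e wdegD; lia.
Qed.

Hypothesis q_unit : forall i j, q i j \is a GRing.unit.

(** Cutting off degree 0 turns a resolution of the quotient into one of [I]: [D 0] becomes the
    augmentation and only the later differentials have to be minimal. *)
Lemma monres_resolution (I : R -> Prop) (J : pred 'X_{1..n}) b a D :
    (forall f, I f <-> forall w, xcoef w f != 0 -> J w) ->
    @is_monres n k q J b a D ->
    (forall l, (1 <= l)%N -> forall i j, xcoef 0%MM (D l i j : R) = 0) ->
  @is_min_gfree_resolution R (whom d) (@maxideal n k q) I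
    (fun l => @row_gfree R (b l) (fun i => (wdeg d (a l.+1 i))%:Z))
    (fun l => mulmxr (D l.+1)) (mulmx_entry (D 0%N)).
Proof.
move=> IJ [a0 homD DD exD augD] minD.
have gf_homE l j v :
    gf_hom (whom d) j
      (v : @row_gfree R (b l) (fun i => (wdeg d (a l.+1 i))%:Z)) ->
    forall i, whom d (j - (wdeg d (a l.+1 i))%:Z) ((v : 'rV[S]_(b l)) 0 i : R).
  case=> c hc -> i; rewrite /= summxE (bigD1 i) //= big1 => [|i' ne].
    by rewrite !mxE !eqxx mulr1 addr0; apply: hc.
  by rewrite !mxE eqxx [i == i']eq_sym (negbTE ne) mulr0.
split.
- split=> [f|p|l p].
  + split=> [/IJ/augD[w ew]|[w <-]].
      exists w; rewrite /= /mulmx_entry -ew mxE eqxx mulr1n //.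
    apply/IJ/augD; exists w; apply/rowP => j.
    by rewrite [LHS]mxE (ord1 j) eqxx mulr1n.
  + split=> [e|[p' <-]].
      have [|w ->] := exD 0%N p; last by exists w.
      by apply/rowP => j; rewrite (ord1 j) [RHS]mxE.
    by rewrite /= /mulmx_entry -mulmxA (DD 0%N) mulmx0 mxE.
  split=> [e|[p' <-]]; first by have [w ->] := exD l.+1 p e; exists w.
  by rewrite /= -mulmxA (DD l.+1) mulmx0.
- move=> j v /gf_homE hv; have := whom_mulmx (l := 0) (homD 0%N) hv.
  by rewrite a0 [wdeg d _]big1 ?subr0 // => i _; rewrite mnm0E muln0.
- move=> l j v /gf_homE hv; exists (fun i => (v *m D l.+1) 0 i).
    by move=> i; apply: whom_mulmx hv.
  exact: row_sum_delta.
move=> l v; exists (b l), (fun i => delta_mx 0 i), (fun i => (v *m D l.+1) 0 i).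
split; last exact: row_sum_delta.
move=> i; apply/(maxidealP q_unit); rewrite mxE xcoef_sum big1 // => j _.
by rewrite converse_mulE -[LHS]/(const_coef _) rmorphM /= /const_coef minD ?mul0r.
Qed.

End Packaging.

Theorem corollary4p1
    (n : nat) (k : comUnitRingType) (k_noetherian : noetherian k)
    (q : 'I_n -> 'I_n -> k)
    (q_unit : forall i j, q i j \is a GRing.unit)
    (q_diag : forall i, q i i = 1)
    (q_inv : forall i j, q j i = (q i j)^-1)
    (d : 'I_n -> nat) (d_pos : forall i, (0 < d i)%N)
    (I : skewpoly q -> Prop) (I_stable : stable_ideal I)
    (G : seq 'X_{1..n}) (G_min : is_min_gens I G) :
  [/\ is_betti (whom d) (@maxideal n k q) I
        (fun p => \sum_(u <- G) 'C(maxv u - 1, p))%N,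
      is_projdim I (\max_(u <- G) (maxv u - 1))%N &
      (forall i, d i = 1%N) ->
        is_poincare_series d I
          (fun j => \sum_(u <- G)
             fps_frac 'X^(wdeg d u) ((1 - 'X) ^+ (n + 1 - maxv u)) j)].
Proof.
have [G_uniq IG G_anti] := G_min; have [_ I_exch] := I_stable.
pose inG w := has (fun v => v <= w)%MM G.
have IP f : I f <-> forall w, xcoef w f != 0 -> inG w.
  by split=> [/IG/(ideal_genP q_unit)|H]; [|apply/IG/(ideal_genP q_unit)].
have I_xmon w : I (xmon q w) <-> inG w.
  rewrite IP; split=> [|Gw w']; first by apply; rewrite xcoef_xmon eqxx oner_eq0.
  by rewrite xcoef_xmon; case: (eqVneq w w') => [<-|]; rewrite ?eqxx.
have G_stable w : inG w -> forall i j : 'I_n,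
    j.+1 = maxv w -> (i.+1 < maxv w)%N -> inG ((U_(i) + w) - U_(j))%MM.
  by move=> /I_xmon Iw i j ej lt; apply/I_xmon/I_exch.
have lq := stable_linear_quotients G_stable G_uniq G_anti.
set s := sort _ _ in lq; have perm_s : perm_eq s G by rewrite perm_sort.
have [a [D [res min _]]] := has_monres_linear_quotients q_unit lq.
have IPs f : I f <-> forall w, xcoef w f != 0 -> has (fun v => v <= w)%MM s.
  by rewrite IP; split=> H w /H; rewrite /inG (perm_has _ perm_s).
have minres := monres_resolution d q_unit IPs res min.
have rkE l : ek_rk s l = (\sum_(u <- G) 'C(maxv u - 1, l))%N.
  by rewrite ek_rkE (perm_big _ perm_s).
have const_J (r : skewpoly q) : maxideal r -> @const_coef n k q r = 0.
  exact: iffRL (maxidealP q_unit r).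
split.
- split=> [|F d' e' minF p]; first by do 3!eexists; exact: minres.
  apply/eqP; rewrite -rkE eqn_leq; apply/andP; split.
    exact: (min_resolution_rank_le const_J minF minres).
  exact: (min_resolution_rank_le const_J minres minF).
- split.
    have [res_I _ _ _] := minres; do 3!eexists; split; first exact: res_I.
      by move=> l; apply: gfree_projective.
    move=> l lt v /=; apply/rowP => - [i lti]; exfalso.
    suff e : ek_rk s l = 0%N by rewrite e in lti.
    rewrite rkE big_seq big1 // => u uG; rewrite bin_small //.
    by apply: leq_ltn_trans lt; apply: (leq_bigmax_seq (F := fun u => (maxv u - 1)%N)).
  move=> m /(min_resolution_length const_J minres) /= rk0.
  (* In degree [maxv u - 1] the generator [u] already contributes a binomial coefficient 1, so the
     rank there is positive. *)
  apply/bigmax_leqP_seq => u uG _; rewrite leqNgt; apply/negP => /rk0/eqP.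
  by rewrite rkE (big_rem u uG) /= binn.
move=> d1 j; exists (count (fun w => has (fun v => v <= w)%MM s) (mons_deg n j)).
  exact: component_rank_count.
rewrite count_linear_quotients // (perm_big _ perm_s) /=.
rewrite (big_morph Posz PoszD (erefl _)); apply: eq_bigr => u _.
rewrite -fps_tail_count ?maxv_le // wdeg_std //.
(* Since [maxv u >= 1], the truncated differences [n - (maxv u - 1)] and [n + 1 - maxv u] agree. *)
by congr (fps_frac _ (_ ^+ _) _); have : (0 < maxv u)%N; [rewrite leq_max|lia].
Qed.
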